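(* Fix $n>P$, $\theta\in\mathbb{R}^P$ and $\sigma>0$. For $s>0$ and $z\in\mathbb{R}^k$ put $\gamma(\xi_{n,q},s)=\Delta_{\sigma\xi_{n,q}}\big(\sqrt n\,\eta_{n,q}(q),\,s c_q\sigma\xi_{n,q}\big)$ and $\gamma^*(\zeta_{n,q},z,s)=\Delta_{\sigma\zeta_{n,q}}\big(\sqrt n\,\eta_{n,q}(q)+b_{n,q}z,\,s c_q\sigma\xi_{n,q}\big)$ for $\mathcal O<q\le P$, and let $h$ be the density of $\hat\sigma/\sigma$, i.e. the density of $(n-P)^{-1/2}$ times the square root of a chi-square random variable with $n-P$ degrees of freedom. Then the model selection probabilities $\pi_{n,\theta,\sigma}(p)=P_{n,\theta,\sigma}(\hat p=p)$ are $$\pi_{n,\theta,\sigma}(\mathcal O)=\int_0^\infty\prod_{q=\mathcal O+1}^P\gamma(\xi_{n,q},s)\,h(s)\,ds,\qquad \pi_{n,\theta,\sigma}(p)=\int_0^\infty(1-\gamma(\xi_{n,p},s))\prod_{q=p+1}^P\gamma(\xi_{n,q},s)\,h(s)\,ds\quad(\mathcal O<p\le P),$$ and the cdf $G_{n,\theta,\sigma}(t)=P_{n,\theta,\sigma}(\sqrt nA(\tilde\theta-\theta)\le t)$ is, for every $t\in\mathbb{R}^k$, $$G_{n,\theta,\sigma}(t)=\Phi_{n,\mathcal O}\big(t-\sqrt nA(\eta_n(\mathcal O)-\theta)\big)\int_0^\infty\prod_{q=\mathcal O+1}^P\gamma(\xi_{n,q},s)h(s)\,ds$$ $$+\sum_{p=\mathcal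 O+1}^P\int_{z\le t-\sqrt nA(\eta_n(p)-\theta)}\Big[\int_0^\infty\big(1-\gamma^*(\zeta_{n,p},z,s)\big)\prod_{q=p+1}^P\gamma(\xi_{n,q},s)h(s)\,ds\Big]\Phi_{n,p}(dz).$$
   Context: Model: $Y=X\theta+u$ with $X$ a non-stochastic $n\times P$ matrix of rank $P$, $n>P\ge1$, $u\sim N(0,\sigma^2I_n)$, $\theta\in\mathbb{R}^P$, $\sigma>0$; $P_{n,\theta,\sigma}$ is the corresponding probability measure. $A$ is a non-stochastic $k\times P$ matrix of rank $k$, $1\le k\le P$. Integer $\mathcal O$ with $0\le\mathcal O<P$. Inequalities between vectors are componentwise; empty products equal one. Notation: for a matrix $D$ with $P$ columns, $D[p]$ is the matrix of its first $p$ columns and $D[\neg p]$ that of its last $P-p$ columns; for $x\in\mathbb{R}^P$, $x[p]$ and $x[\neg p]$ are the vectors of its first $p$ and last $P-p$ components; $x_i$ is the $i$-th component of $x$. Estimators: for $0\le p\le P$, $\tilde\theta(p)\in\mathbb{R}^P$ is the restricted least-squares estimator with first $p$ components $(X[p]'X[p])^{-1}X[p]'Y$ and last $P-p$ components zero ($\tilde\theta(0)=0$). $\tilde\theta_p(p)$ is its $p$-th component. $\hat\sigma^2=(n-P)^{-1}(Y-X\tilde\theta(P))'(Y-X\tilde\theta(P))$. For $0<p\le P$, $\xi_{n,p}=\big([(X[p]'X[p]/n)^{-1}]_{p,p}\big)^{1/2}$ and $T_p=\sqrt n\,\tilde\theta_p(p)/(\hat\sigma\xi_{n,p})$; $T_0=0$.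 Critical values: $0<c_p<\infty$ for $\mathcal O<p\le P$ and $c_{\mathcal O}=0$. The model selector is $\hat p=\max\{p:\ |T_p|\ge c_p,\ \mathcal O\le p\le P\}$ and the post-model-selection estimator is $\tilde\theta=\sum_{p=\mathcal O}^P\tilde\theta(p)\mathbf 1\{\hat p=p\}$. Further quantities: $\eta_n(p)\in\mathbb{R}^P$ is the mean of $\tilde\theta(p)$: its first $p$ components are $\theta[p]+(X[p]'X[p])^{-1}X[p]'X[\neg p]\theta[\neg p]$ and the rest are zero ($\eta_n(0)=0$, $\eta_n(P)=\theta$); $\eta_{n,p}(p)$ is its $p$-th component. $\Phi_{n,p}$ is the cdf (and the induced measure) on $\mathbb{R}^k$ of the centered Gaussian distribution with covariance matrix $\sigma^2A[p](X[p]'X[p]/n)^{-1}A[p]'$ for $p>0$, and of point mass at $0$ for $p=0$. For $p>0$: $C_n^{(p)}=A[p](X[p]'X[p]/n)^{-1}e_p$ with $e_p$ the $p$-th standard basis vector of $\mathbb{R}^p$; $b_{n,p}=C_n^{(p)\prime}\big(A[p](X[p]'X[p]/n)^{-1}A[p]'\big)^{-}$, where $(\cdot)^-$ is a generalized inverse ($b_{n,p}z$ does not depend on its choice for $z$ in the column space of $A[p]$, where $\Phi_{n,p}$ is concentrated); $\zeta_{n,p}\ge0$ with $\zeta_{n,p}^2=\xi_{n,p}^2-b_{n,p}C_n^{(p)}$. $\Delta_s(a,b)=P(|M-a|<b)$ for $M\sim N(0,s^2)$, $s\ge0$ ($M=0$ if $s=0$, so $\Delta_0(a,b)=1$ if $|a|<b$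 and $0$ otherwise). *)

(* Defs.v *)
From HB Require Import structures.
From mathcomp Require Import all_boot all_order all_algebra.
From mathcomp Require Import all_classical all_reals all_analysis.
From mathcomp Require Import ring lra.

Set Implicit Arguments.
Unset Strict Implicit.
Unset Printing Implicit Defensive.

Import Order.TTheory GRing.Theory Num.Theory.
Import numFieldNormedType.Exports.

Local Open Scope classical_set_scope.
Local Open Scope ring_scope.

(* The product (Borel) sigma-algebra on matrices, generated by the entries.   *)
Section measurable_matrix.
Context {d} {T : measurableType d}.
Variables m n : nat.

Definition mx_entry_sets : set (set 'M[T]_(m, n)) :=
  \bigcup_(ij in [set: 'I_m * 'I_n])
    preimage_set_system setT (fun M : 'M[T]_(m, n) => M ij.1 ij.2) measurable.

Let mx0 : <<s mx_entry_sets >> set0.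
Proof. exact: sigma_algebra0. Qed.

Let mxC A : <<s mx_entry_sets >> A -> <<s mx_entry_sets >> (~` A).
Proof. exact: sigma_algebraC. Qed.

Let mx_bigcup (F : (set 'M[T]_(m, n))^nat) :
  (forall i, <<s mx_entry_sets >> (F i)) ->
  <<s mx_entry_sets >> (\bigcup_i (F i)).
Proof. exact: sigma_algebra_bigcup. Qed.

HB.instance Definition _ := @isMeasurable.Build (sigma_display mx_entry_sets)
  'M[T]_(m, n) <<s mx_entry_sets >> mx0 mxC mx_bigcup.

Lemma measurable_mx_entry (i : 'I_m) (j : 'I_n) :
  measurable_fun [set: 'M[T]_(m, n)] (fun M : 'M[T]_(m, n) => M i j).
Proof.
move=> _ B mB; apply: sub_sigma_algebra; exists (i, j) => //.
by exists B.
Qed.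

Lemma measurable_fun_mxP d' (S : measurableType d') (f : S -> 'M[T]_(m, n)) :
  measurable_fun setT f <->
  forall i j, measurable_fun setT (fun x => f x i j).
Proof.
split=> [mf i j|mf].
  exact: (measurableT_comp (measurable_mx_entry i j) mf).
apply: (measurability mx_entry_sets) => //.
move=> _ [_ [[i j] _ [B mB <-]] <-].
by rewrite !setTI; have := mf i j measurableT B mB; rewrite setTI.
Qed.

End measurable_matrix.

Section gaussian.
Context {R : realType}.

Definition vcons n (x : measurableTypeR R * 'cV[R]_n) : 'cV[R]_n.+1 := col_mx x.1%:M x.2.

Lemma measurable_vcons n : measurable_fun setT (@vcons n).
Proof.
apply/measurable_fun_mxP => i j; rewrite /vcons.
rewrite (_ : (fun _ => _) = fun x : measurableTypeR R * 'cV[R]_n =>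
    match @fintype.split 1 n i with inl _ => x.1 | inr k => x.2 k j end).
  case: (fintype.split _) => k; first exact: measurable_fst.
  exact: (measurableT_comp (measurable_mx_entry k j)
    (@measurable_snd _ _ _ _)).
apply/funext => x; rewrite mxE; case: (fintype.split _) => k //.
by rewrite mxE !ord1 eqxx.
Qed.

HB.instance Definition _ n := isMeasurableFun.Build _ _ _ _ (@vcons n)
  (@measurable_vcons n).

(* N(0, I_n), the n-fold product of N(0, 1). *)
Fixpoint std_gaussian (n : nat) : probability 'cV[R]_n R :=
  match n with
  | 0 => \d_(0 : 'cV[R]_0)
  | n'.+1 => distribution (normal_prob 0 1 \x std_gaussian n')%E
               (@vcons n')
  end.

Definition mxact m n (L : 'M[R]_(m, n)) (x : 'cV[R]_n) : 'cV[R]_m := L *m x.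

Lemma measurable_mxact m n (L : 'M[R]_(m, n)) : measurable_fun setT (mxact L).
Proof.
apply/measurable_fun_mxP => i j; rewrite /mxact.
under eq_fun do rewrite mxE.
apply: measurable_sum => l; apply: measurable_realfun.measurable_funM => //.
exact: measurable_mx_entry.
Qed.

HB.instance Definition _ m n (L : 'M[R]_(m, n)) :=
  isMeasurableFun.Build _ _ _ _ (mxact L) (measurable_mxact L).

(* Lower triangular square root of a positive semidefinite matrix, which may
   be singular: by x^-1 = 0 for x = 0, a vanishing pivot gives a zero column. *)
Fixpoint cholesky n : 'M[R]_n -> 'M[R]_n :=
  match n with
  | 0 => id
  | n'.+1 => fun S =>
      let S' : 'M[R]_(1 + n') := S in
      let c := Num.sqrt (S' 0 0) in
      let v := c^-1 *: dlsubmx S' in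
      block_mx c%:M 0 v (cholesky (drsubmx S' - v *m v^T))
  end.

Let quad_ge0 (a b e : R) : (forall t, 0 <= a * t ^+ 2 + 2 * t * b + e) ->
  [/\ 0 <= a, a = 0 -> b = 0 & (Num.sqrt a)^-1 ^+ 2 * b ^+ 2 <= e].
Proof.
move=> h.
have e0 : 0 <= e by have := h 0; rewrite expr0n /=; lra.
have a0 : 0 <= a.
  rewrite leNgt; apply/negP => a_lt0; pose t := 1 - e / a.
  have et : e = a * (1 - t) by rewrite /t; field; rewrite lt_eqF.
  have := h t; have := h (- t); have := sqr_ge0 (t - 2^-1); rewrite et; nra.
split=> //.
- move=> az; apply/eqP/negPn/negP => bn0; have := h (- (e + 1) / (2 * b)).
  rewrite az mul0r add0r.
  have -> : 2 * (- (e + 1) / (2 * b)) * b = - (e + 1) by field.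
  lra.
- have [->|an0] := eqVneq a 0; first by rewrite sqrtr0 invr0 expr0n /= mul0r.
  rewrite exprVn sqr_sqrtr//; have := h (- b / a).
  have -> : a * (- b / a) ^+ 2 + 2 * (- b / a) * b + e = e - a^-1 * b ^+ 2.
    by field.
  by rewrite subr_ge0.
Qed.

Lemma choleskyP n (S : 'M[R]_n) :
  S^T = S -> (forall x : 'cV[R]_n, 0 <= (x^T *m S *m x) 0 0) ->
  cholesky S *m (cholesky S)^T = S.
Proof.
elim: n S => [S _ _|n IH S symS posS]; first by apply/matrixP => -[].
rewrite -[n.+1]/(1 + n)%N in S symS posS *.
pose a := S 0 0; pose w : 'cV[R]_n := dlsubmx S; pose D := drsubmx S.
have Sul : ulsubmx S = a%:M by rewrite [LHS]mx11_scalar !mxE lshift0.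
have Sur : ursubmx S = w^T by rewrite /w -[in RHS]symS -trmx_ursub trmxK.
have symD : D^T = D by rewrite /D trmx_drsub symS.
have SE : S = block_mx a%:M w^T w D by rewrite -[LHS]submxK Sul Sur.
have q (y : 'cV[R]_n) t : 0 <= a * t ^+ 2 + 2 * t * (w^T *m y) 0 0 + (y^T *m D *m y) 0 0.
  have := posS (col_mx t%:M y).
  rewrite SE tr_col_mx mul_row_block mul_row_col tr_scalar_mx.
  rewrite -scalar_mxM mulmxDl -scalar_mxM !mul_mx_scalar !mul_scalar_mx.
  rewrite mulmxDl -scalemxAl -[y^T *m w]trmxK trmx_mul trmxK !mxE eqxx mulr1n.
  by move=> h; lra.
have [a0 _ _] := quad_ge0 (q 0).
set c := Num.sqrt a; set v := c^-1 *: w.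
have wc : c *: v = w.
  have [cz|cn0] := eqVneq c 0; last by rewrite scalerA divff// scale1r.
  have az : a = 0 by apply/eqP; rewrite eq_le a0 -sqrtr_eq0 -/c cz eqxx.
  rewrite cz scale0r; apply/esym/colP => i; rewrite [RHS]mxE.
  have [_ /(_ az) + _] := quad_ge0 (q (delta_mx i 0)).
  by rewrite -colE !mxE.
rewrite [cholesky S]/= -/c -/v -/w -/D -/a -/c -/v.
rewrite tr_block_mx mulmx_block.
rewrite ?(trmx0, mulmx0, mul0mx, addr0, add0r) tr_scalar_mx.
rewrite -scalar_mxM -expr2 sqr_sqrtr// mul_scalar_mx mul_mx_scalar.
rewrite -linearZ /= wc IH ?subrKC// => [|y].
  by rewrite linearB /= trmx_mul trmxK symD.
have [_ _ +] := quad_ge0 (q y); rewrite -/c -subr_ge0.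
congr (0 <= _).
have vy : (v^T *m y) 0 0 = c^-1 * (w^T *m y) 0 0.
  by rewrite linearZ /= -scalemxAl [LHS]mxE.
have yv : y^T *m v = v^T *m y.
  rewrite -[LHS]trmxK trmx_mul trmxK.
  by rewrite (mx11_scalar (v^T *m y)) tr_scalar_mx.
have -> : y^T *m (D - v *m v^T) *m y
          = y^T *m D *m y - (v^T *m y) *m (v^T *m y).
  by rewrite mulmxBr mulmxBl !mulmxA yv.
have subE (M N : 'M[R]_1) : (M - N) 0 0 = M 0 0 - N 0 0 by rewrite !mxE.
have mulE (M N : 'M[R]_1) : (M *m N) 0 0 = M 0 0 * N 0 0.
  by rewrite mxE big_ord1.
by rewrite subE mulE vy; ring.
Qed.

(* N(0, S), the law of L xi with L L^T = S and xi ~ N(0, I_n). *)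
Definition gaussian n (S : 'M[R]_n) : probability 'cV[R]_n R :=
  distribution (std_gaussian n) (mxact (cholesky S)).

(* N(0, s^2) on the line; normal_prob is a junk value at s = 0. *)
Definition normal0 (s : R) : set (measurableTypeR R) -> \bar R :=
  if s == 0 then \d_(0 : measurableTypeR R) else normal_prob 0 s.

Definition Delta (s a b : R) : R :=
  fine (normal0 s [set x : R | `|x - a| < b]).

Definition chi_square (m : nat) : set R -> \bar R :=
  pushforward (std_gaussian m) (fun x : 'cV[R]_m => \sum_i x i 0 ^+ 2).

(* The law of m^(-1/2) times the square root of a chi-square variable with m
   degrees of freedom. *)
Definition scaled_chi (m : nat) : set R -> \bar R :=
  pushforward (chi_square m) (fun y : R => (Num.sqrt m%:R)^-1 * Num.sqrt y).

Definition is_density (mu : set R -> \bar R) (h : R -> R) :=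
  [/\ measurable_fun [set: R] h, forall x, 0 <= h x &
      forall B : set R, measurable B ->
        mu B = (\int[lebesgue_measure]_(x in B) (h x)%:E)%E].

End gaussian.

(* Model orders p range over 'I_P.+1 = {0, ..., P}; components of vectors and
   entries of matrices attached to an order p are numbered from 1. *)
Section linear_model.
Context {R : realType}.

(* D[p], D[~p], x[p], x[~p] *)
Definition fcols m P (p : 'I_P.+1) (D : 'M[R]_(m, P)) : 'M[R]_(m, p) :=
  colsub (widen_ord (leq_ord p)) D.

Definition lcols m P (p : 'I_P.+1) (D : 'M[R]_(m, P)) : 'M[R]_(m, P - p) :=
  colsub (fun j => cast_ord (subnKC (leq_ord p)) (rshift p j)) D.

Definition frows P (p : 'I_P.+1) (x : 'cV[R]_P) : 'cV[R]_p :=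
  rowsub (widen_ord (leq_ord p)) x.

Definition lrows P (p : 'I_P.+1) (x : 'cV[R]_P) : 'cV[R]_(P - p) :=
  rowsub (fun j => cast_ord (subnKC (leq_ord p)) (rshift p j)) x.

(* (y, 0, ..., 0) *)
Definition zero_pad P p (y : 'cV[R]_p) : 'cV[R]_P :=
  \col_i (if insub (i : nat) is Some j then y j 0 else 0).

(* The entry (i, j) in 1-based numbering, meaningful for 1 <= i <= m and
   1 <= j <= n. *)
Definition entry m n (M : 'M[R]_(m, n)) (i j : nat) : R :=
  if (insub i.-1, insub j.-1) is (Some a, Some b) then M a b else 0.

Definition coordinate P (x : 'cV[R]_P) (i : nat) : R := entry x i 1.

Definition last_basis p : 'cV[R]_p := \col_i (i.+1 == p)%:R.

Definition generalized_inverse k (M G : 'M[R]_k) := M *m G *m M = M.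

Section design.
Variables n P : nat.
Variable X : 'M[R]_(n, P).
Implicit Types (p q : 'I_P.+1) (Y : 'cV[R]_n).

Definition theta_tilde p Y : 'cV[R]_P :=
  zero_pad P (invmx ((fcols p X)^T *m fcols p X) *m (fcols p X)^T *m Y).

Definition sigma_hat Y : R :=
  let r := Y - X *m theta_tilde ord_max Y in
  Num.sqrt ((n - P)%:R^-1 * (r^T *m r) 0 0).

(* (X[p]'X[p] / n)^(-1) *)
Definition inv_gram p : 'M[R]_p :=
  invmx (n%:R^-1 *: ((fcols p X)^T *m fcols p X)).

Definition xi p : R := Num.sqrt (entry (inv_gram p) p p).

Definition T_stat p Y : R :=
  if p == 0 :> nat then 0
  else Num.sqrt n%:R * coordinate (theta_tilde p Y) p / (sigma_hat Y * xi p).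

Section selection.
Variables (O : 'I_P.+1) (c : 'I_P.+1 -> R).

Definition p_hat Y : nat :=
  \max_(p < P.+1 | (O <= p)%N && (c p <= `|T_stat p Y|)) p.

Definition theta_pms Y : 'cV[R]_P :=
  \sum_(p < P.+1 | (O <= p)%N) (p_hat Y == p)%:R *: theta_tilde p Y.

End selection.

Section law.
Variables (theta : 'cV[R]_P) (sigma : R) (c : 'I_P.+1 -> R).

Definition eta_n p : 'cV[R]_P :=
  zero_pad P (frows p theta + invmx ((fcols p X)^T *m fcols p X) *m
    (fcols p X)^T *m lcols p X *m lrows p theta).

Definition gamma q (s : R) : R :=
  Delta (sigma * xi q) (Num.sqrt n%:R * coordinate (eta_n q) q)
    (s * c q * sigma * xi q).

Section target.
Variables (k : nat) (A : 'M[R]_(k, P)).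

Definition lin_cov p : 'M[R]_k :=
  fcols p A *m inv_gram p *m (fcols p A)^T.

(* At p = 0 the covariance is an empty sum, and gaussian 0 is the point mass
   at 0. *)
Definition Phi p : probability 'cV[R]_k R :=
  gaussian (sigma ^+ 2 *: lin_cov p).

Definition C_vec p : 'cV[R]_k := fcols p A *m inv_gram p *m last_basis p.

(* G p is a generalized inverse of lin_cov p. *)
Variable G : 'I_P.+1 -> 'M[R]_k.

Definition b_vec p : 'rV[R]_k := (C_vec p)^T *m G p.

Definition zeta p : R := Num.sqrt (xi p ^+ 2 - (b_vec p *m C_vec p) 0 0).

Definition gamma_star q (z : 'cV[R]_k) (s : R) : R :=
  Delta (sigma * zeta q)
    (Num.sqrt n%:R * coordinate (eta_n q) q + (b_vec q *m z) 0 0)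
    (s * c q * sigma * xi q).

End target.
End law.
End design.
End linear_model.

Definition lower_orthant {R : realType} k (t : 'cV[R]_k) : set 'cV[R]_k :=
  [set z | forall i, z i 0 <= t i 0].

(* Main.v *)
Require Import Defs.
From HB Require Import structures.
From mathcomp Require Import all_boot all_order all_algebra.
From mathcomp Require Import all_classical all_reals all_analysis.
From mathcomp Require Import measurable_realfun ring.

Set Implicit Arguments.
Unset Strict Implicit.
Unset Printing Implicit Defensive.

Import Order.TTheory GRing.Theory Num.Theory.
Import numFieldNormedType.Exports.

Local Open Scope classical_set_scope.
Local Open Scope ring_scope.

(* Write X = F U with F'F = 1 and U upper triangular with positive diagonal, and
   let E be an orthonormal basis of the orthogonal complement. With
   w = F'u / sigma and v = E'u / sigma, the q-th t-statistic is an affine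
   function of the q-th coordinate of w divided by the root mean square of v,
   and the restricted estimator of order p depends on the first p coordinates
   only. Hence the target, the residual scale and the statistics of order > p
   are independent, and the p-th statistic is split into its regression on the
   target, with coefficient b, and an independent error of variance zeta^2.
   Conditioning on the scale and then on the target gives the integrals.

   The laws are compared through one fact: the law of M xi, for xi standard
   Gaussian, depends on M M' only. It is reduced, one column of M at a time, to
   the rotation invariance of the standard Gaussian law of the plane, which
   follows from two affine changes of variable. *)

(** * Changes of variables on the line *)

(** So a Gaussian law is handled as the image of a standard one by a matrix, and no conditional law
    is introduced: the vector of target, residual and statistics is [H x], the vector described by
    the formulas is [K y] with [K] block lower triangular, [x] and [y] are standard, and
    [H H' = K K'] makes the laws equal. Regression on the target is the matrix identity behind that
    equality, and a generalized inverse suffices for it. The Cholesky factor is the canonical square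
    root, for singular matrices too, and also yields the triangular factor of the design.

    The order [O] is covered by the general formula: as [c O = 0] its test always passes, and
    [Delta] with radius 0 vanishes, so the factor [1 - gamma] becomes 1. For [O = 0] the conventions
    [xi = 0] at order 0 and [x / 0 = 0] agree with [T_0 = 0]. The selection probabilities are the
    case [A = 0] of the joint law. *)

Section affine_substitution.
Context {R : realType}.
Local Open Scope ereal_scope.
Notation mu := (@lebesgue_measure R).

Lemma measurable_affine (a b : R) :
  measurable_fun setT (fun x : measurableTypeR R => (a * x + b)%R : measurableTypeR R).
Proof. by apply: measurable_funD => //; exact: mulrl_measurable. Qed.

(** The rescaled image measure agrees with Lebesgue measure on half-open intervals, which determine
    it. For [a < 0] the preimage has its closed end on the other side, hence the two
    computations. *)
Lemma lebesgue_measure_affine (a b : R) (A : set (measurableTypeR R)) :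
  a != 0%R -> measurable A ->
  mu A = `|a|%:E * mu ((fun x => (a * x + b)%R) @^-1` A).
Proof.
move=> a0 mA; have na : (0 <= `|a|)%R by [].
pose nu := measure_function_pushforward__canonical__measure_function_Measure mu
  (measurable_affine a b).
transitivity (mscale (NngNum na) nu A); last by [].
apply: lebesgue_measure_unique => // _ [[c d]] _ <-.
change (mu `]c, d] = `|a|%:E * mu ((fun x => a * x + b)%R @^-1` `]c, d]))%classic.
have [a_gt0|a_lt0|a_eq0] := ltrgtP 0%R a; last by rewrite a_eq0 eqxx in a0.
- rewrite (_ : _ @^-1` _ = `](c - b) / a, (d - b) / a]%classic)%R; last first.
    apply/seteqP; split=> x /=; rewrite !in_itv /= ltr_pdivrMr// ler_pdivlMr//;
      rewrite ![(x * a)%R]mulrC ltrBlDr lerBrDr //.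
  rewrite !lebesgue_measure_itv /= !lte_fin ltr_pM2r ?invr_gt0// ltrD2r.
  case: ifP => _; last by rewrite mule0.
  rewrite -!EFinD -EFinM; congr EFin; rewrite gtr0_norm//.
  by field; rewrite gt_eqF.
- rewrite (_ : _ @^-1` _ = `[(d - b) / a, (c - b) / a[%classic)%R; last first.
    apply/seteqP; split=> x /=; rewrite !in_itv /= ltr_ndivlMr// ler_ndivrMr//;
      rewrite ![(x * a)%R]mulrC ltrBlDr lerBrDr andbC //.
  rewrite !lebesgue_measure_itv /= !lte_fin ltr_nM2r ?invr_lt0// ltrD2r.
  case: ifP => _; last by rewrite mule0.
  rewrite -!EFinD -EFinM; congr EFin; rewrite ltr0_norm//.
  by field; rewrite lt_eqF.
Qed.

Lemma ge0_integral_affine (a b : R) (f : measurableTypeR R -> \bar R) : a != 0%R ->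
  measurable_fun setT f -> (forall x, 0 <= f x) ->
  \int[mu]_x f x = `|a|%:E * \int[mu]_x f (a * x + b)%R.
Proof.
move=> a0 mf f0.
have na : (0 <= `|a|)%R by [].
have mg := measurable_affine a b.
have ag : measurable_fun setT (fun x : measurableTypeR R => f (a * x + b)%R).
  exact: (measurableT_comp mf mg).
pose nu := measure_function_pushforward__canonical__measure_function_Measure mu mg.
have fE : \int[nu]_x f x = \int[mu]_x f (a * x + b)%R.
  by rewrite (ge0_integral_pushforward mg).
rewrite -fE -(ge0_integral_mscale _ measurableT (NngNum na))//.
by apply: eq_measure_integral => A mA _; exact: lebesgue_measure_affine.
Qed.
End affine_substitution.

Section density.
Context d (T : measurableType d) {R : realType}.
Local Open Scope ereal_scope.

Import HBNNSimple.

(** The set-wise hypothesis is the form in which both [normal_prob] and [is_density] present a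
    density. Linearity settles simple functions, monotone convergence the rest. *)
Lemma ge0_integral_density (mu nu : {measure set T -> \bar R}) (h : T -> R)
  (f : T -> \bar R) :
  measurable_fun setT h -> (forall x, 0 <= h x)%R ->
  (forall A, measurable A -> nu A = \int[mu]_(x in A) (h x)%:E) ->
  measurable_fun setT f -> (forall x, 0 <= f x) ->
  \int[nu]_x f x = \int[mu]_x (f x * (h x)%:E).
Proof.
move=> mh h0 nuE mf f0; have mhE : measurable_fun setT (EFin \o h) by exact/measurable_EFinP.
pose g := nnsfun_approx measurableT mf.
have mgE n : measurable_fun setT (fun x => (g n x)%:E) by exact/measurable_EFinP.
have g_cvg x : (g n x)%:E @[n --> \oo] --> f x by exact: cvg_nnsfun_approx.
have g_nd x : nondecreasing_seq (fun n => (g n x)%:E).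
  by move=> m n mn; rewrite lee_fin; exact/lefP/nd_nnsfun_approx.
have gS n : \int[nu]_x (g n x)%:E = \int[mu]_x ((g n x)%:E * (h x)%:E).
  under eq_integral do rewrite fimfunE -fsumEFin//.
  rewrite ge0_integral_fsum//; last 2 first.
  - by move=> r; exact/measurable_EFinP/measurable_funM.
  - by move=> r x _; rewrite nnfun_muleindic_ge0.
  under [RHS]eq_integral => x _.
    rewrite fimfunE -fsumEFin// ge0_mule_fsuml; last first.
      by move=> r; rewrite EFinM nnfun_muleindic_ge0.
    over.
  rewrite [RHS]ge0_integral_fsum//; last 2 first.
  - by move=> r; apply: emeasurable_funM => //; exact/measurable_EFinP/measurable_funM.
  - by move=> r x _; rewrite mule_ge0 ?lee_fin// ?h0// -lee_fin EFinM nnfun_muleindic_ge0.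
  apply: eq_fsbigr => r _; rewrite integralZl_indic_nnsfun// integral_indic// setIT nuE//.
  have [r0|r_lt0] := leP 0%R r; last first.
    rewrite preimage_nnfun0// integral_set0 mule0 integral0_eq// => x _.
    by rewrite indic0 mulr0 mul0e.
  rewrite integral_mkcond -ge0_integralZl//; last 2 first.
  - exact/(measurable_restrictT _ _).1/measurable_funTS.
  - by move=> x _; apply: erestrict_ge0 => y _; rewrite lee_fin.
  apply: eq_integral => x _; rewrite patchE indicE; case: ifPn => _.
    by rewrite mulr1.
  by rewrite mulr0 mul0e mule0.
transitivity (limn (fun n => \int[nu]_x (g n x)%:E)).
  rewrite -monotone_convergence//; last by move=> n x _; rewrite lee_fin.
  by apply: eq_integral => x _; apply/esym/cvg_lim.
have -> : (fun n => \int[nu]_x (g n x)%:E) =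
    fun n => \int[mu]_x ((g n x)%:E * (h x)%:E) by exact/funext.
rewrite -monotone_convergence//.
- by apply: eq_integral => x _; apply/cvg_lim => //; exact: cvgeZr.
- by move=> n; apply: emeasurable_funM.
- by move=> n x _; rewrite mule_ge0 ?lee_fin.
- by move=> x _ m n mn; rewrite lee_wpmul2r ?lee_fin//; exact: g_nd.
Qed.
End density.

(** * Rotation invariance of the standard Gaussian law of the plane *)

Section rotation.
Context {R : realType}.
Local Open Scope ereal_scope.
Notation mu := (@lebesgue_measure R).
Notation T := (measurableTypeR R).
Notation N01 := (normal_prob (0 : R) 1).

Lemma ge0_integral_std_normal (f : T -> \bar R) :
  measurable_fun setT f -> (forall x, 0 <= f x) ->
  \int[N01]_x f x = \int[mu]_x (f x * (normal_pdf 0 1 x)%:E).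
Proof.
move=> mf f0; apply: ge0_integral_density => //.
- exact: measurable_normal_pdf.
- exact: normal_pdf_ge0.
Qed.

Lemma measurable_affine2 (a b c : R) :
  measurable_fun setT (fun z : T * T => (a * z.1 + b * z.2 + c)%R : T).
Proof.
by do 2 apply: measurable_funD => //; apply: measurable_funM => //.
Qed.

(** For [a != 0] the rotation is undone by two substitutions in one variable each: [a * x + b * y]
    for [x] at fixed [y], then [a * y + b * x] for [y] at fixed [x]. The factors [|a|^-1] and [|a|]
    cancel; Tonelli's theorem exchanges the integrals in between. *)
Let ge0_integral_rot_lebesgue (F : T * T -> \bar R) (a b : R) :
  a != 0%R -> (a ^+ 2 + b ^+ 2 = 1)%R ->
  measurable_fun setT F -> (forall z, 0 <= F z) ->
  \int[mu]_x \int[mu]_y F (x, y) =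
  \int[mu]_x \int[mu]_y F (a * x + b * y, - b * x + a * y)%R.
Proof.
move=> a0 ab mF F0.
have mFxy (u v : T * T -> T) : measurable_fun setT u -> measurable_fun setT v ->
    measurable_fun setT (fun z => F (u z, v z)).
  by move=> mu' mv; apply: (measurableT_comp mF); exact/measurable_fun_pair.
have e1 : (fun z : T * T => F (a * z.1 + b * z.2, - b * z.1 + a * z.2)%R) =
    fun z => F ((a * z.1 + b * z.2 + 0, - b * z.1 + a * z.2 + 0)%R).
  by apply/funext => z; rewrite !addr0.
have mF1 : measurable_fun setT
    (fun z : T * T => F (a * z.1 + b * z.2, - b * z.1 + a * z.2)%R).
  by rewrite e1; apply: mFxy; exact: measurable_affine2.
have e2 : (fun z : T * T => F (z.1, (z.2 - b * z.1) / a)%R) =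
    fun z => F ((1 * z.1 + 0 * z.2 + 0, - b / a * z.1 + a^-1 * z.2 + 0)%R).
  by apply/funext => z; congr F; congr pair; ring.
have mF2 : measurable_fun setT (fun z : T * T => F (z.1, (z.2 - b * z.1) / a)%R).
  by rewrite e2; apply: mFxy; exact: measurable_affine2.
have na : `|a|%:E * `|a|^-1%:E = 1 by rewrite -EFinM divff// normr_eq0.
apply/esym.
have mF2r y : measurable_fun setT (fun x : T => F (x, (y - b * x) / a)%R).
  exact: (measurableT_comp mF2 (pair2_measurable y)).
have /= -> := @fubini_tonelli _ _ _ _ _ mu mu _ mF1 (fun=> F0 _).
transitivity (\int[mu]_y \int[mu]_x (`|a|^-1%:E * F (x, (y - b * x) / a)%R)).
  apply: eq_integral => y _; rewrite ge0_integralZl//.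
  rewrite [in RHS](@ge0_integral_affine R a (b * y))//.
  rewrite muleA [X in X * _]muleC na mul1e; apply: eq_integral => x _ /=.
  congr F; congr pair; apply: (mulIf a0); rewrite divfK//.
  rewrite mulrDl mulrDr opprD addrA.
  have -> : (b * (b * y) = (1 - a ^+ 2) * y)%R by rewrite -ab; ring.
  ring.
have mF3 : measurable_fun setT (fun z : T * T => `|a|^-1%:E * F (z.1, (z.2 - b * z.1) / a)%R).
  exact: measurable_funeM.
have F3 (z : T * T) : 0 <= `|a|^-1%:E * F (z.1, (z.2 - b * z.1) / a)%R.
  by rewrite mule_ge0// lee_fin.
have /= <- := @fubini_tonelli _ _ _ _ _ mu mu _ mF3 F3.
apply: eq_integral => x _ /=; rewrite ge0_integralZl//; last exact: (measurableT_comp mF2 (pair1_measurable x)).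
rewrite (@ge0_integral_affine R a (b * x))//; last first.
  exact: (measurableT_comp mF2 (pair1_measurable x)).
rewrite muleA [X in X * _]muleC na mul1e; apply: eq_integral => y _ /=.
by congr F; congr pair; rewrite addrK mulrC mulKf.
Qed.

Let ge0_integral2_std_normal (f : T * T -> \bar R) :
  measurable_fun setT f -> (forall z, 0 <= f z) ->
  \int[N01]_x \int[N01]_y f (x, y) = \int[mu]_x \int[mu]_y
    (f (x, y) * (normal_pdf 0 1 x * normal_pdf 0 1 y)%:E).
Proof.
move=> mf f0.
have p0 x : 0 <= (normal_pdf (0:R) 1 x)%:E by rewrite lee_fin normal_pdf_ge0.
have mp : measurable_fun setT (fun x : T => (normal_pdf (0:R) 1 x)%:E).
  by apply/measurable_EFinP; exact: measurable_normal_pdf.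
rewrite ge0_integral_std_normal//; last 2 first.
- exact: measurable_fun_fubini_tonelli_F.
- by move=> x; exact: integral_ge0.
apply: eq_integral => x _.
rewrite ge0_integral_std_normal//; last exact: (measurableT_comp mf (pair1_measurable x)).
rewrite -ge0_integralZr//; last 2 first.
- apply: emeasurable_funM => //; exact: (measurableT_comp mf (pair1_measurable x)).
- by move=> y _; rewrite mule_ge0.
by apply: eq_integral => y _; rewrite -muleA -EFinM [(_ * normal_pdf 0 1 x)%R]mulrC.
Qed.

Let ge0_integral_rot_neq0 (f : T * T -> \bar R) (a b : R) :
  a != 0%R -> (a ^+ 2 + b ^+ 2 = 1)%R ->
  measurable_fun setT f -> (forall z, 0 <= f z) ->
  \int[N01]_x \int[N01]_y f (x, y) =
  \int[N01]_x \int[N01]_y f (a * x + b * y, - b * x + a * y)%R.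
Proof.
move=> a0 ab mf f0.
have e1 : (fun z : T * T => f (a * z.1 + b * z.2, - b * z.1 + a * z.2)%R) =
    fun z => f ((a * z.1 + b * z.2 + 0, - b * z.1 + a * z.2 + 0)%R).
  by apply/funext => z; rewrite !addr0.
rewrite ge0_integral2_std_normal//.
have mf1 : measurable_fun setT
    (fun z : T * T => f (a * z.1 + b * z.2, - b * z.1 + a * z.2)%R).
  rewrite e1; apply: (measurableT_comp mf).
  by apply/measurable_fun_pair; exact: measurable_affine2.
have /= -> := ge0_integral2_std_normal mf1 (fun=> f0 _).
pose G (z : T * T) := f z * (normal_pdf 0 1 z.1 * normal_pdf 0 1 z.2)%:E.
have mG : measurable_fun setT G.
  apply: emeasurable_funM => //; apply/measurable_EFinP.
  apply: measurable_funM.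
    exact: (measurableT_comp (measurable_normal_pdf 0 1) measurable_fst).
  exact: (measurableT_comp (measurable_normal_pdf 0 1) measurable_snd).
have G0 z : 0 <= G z by rewrite mule_ge0// lee_fin mulr_ge0// normal_pdf_ge0.
transitivity (\int[mu]_x \int[mu]_y G (x, y)); first by [].
rewrite (ge0_integral_rot_lebesgue a0 ab mG G0).
apply: eq_integral => x _; apply: eq_integral => y _; rewrite /G; congr (_ * _%:E).
rewrite !normal_pdfE ?oner_eq0// /normal_fun !subr0 [LHS]/= [RHS]/=.
rewrite mulrACA [RHS]mulrACA -!expRD; congr (_ * expR _)%R.
rewrite -!mulrDl; congr (_ / _)%R.
(* Weighting by [a ^+ 2 + b ^+ 2 = 1] turns the invariance of [x ^+ 2 + y ^+ 2] into a polynomial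
   identity. *)
have -> : (x ^+ 2 = (a ^+ 2 + b ^+ 2) * x ^+ 2)%R by rewrite ab mul1r.
have -> : (y ^+ 2 = (a ^+ 2 + b ^+ 2) * y ^+ 2)%R by rewrite ab mul1r.
ring.
Qed.

Lemma ge0_integral_std_normal_rot (f : T * T -> \bar R) (a b : R) :
  (a ^+ 2 + b ^+ 2 = 1)%R ->
  measurable_fun setT f -> (forall z, 0 <= f z) ->
  \int[N01]_x \int[N01]_y f (x, y) =
  \int[N01]_x \int[N01]_y f (a * x + b * y, - b * x + a * y)%R.
Proof.
move=> ab mf f0; have [a0|a0] := eqVneq a 0%R; last exact: (ge0_integral_rot_neq0 a0 ab mf f0).
(* A quarter turn is the square of a rotation with nonzero cosine. *)
pose r : R := ((Num.sqrt 2)^-1)%R.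
have r2 : (r ^+ 2 = 2^-1)%R by rewrite exprVn sqr_sqrtr.
have b2 : (b ^+ 2 = 1)%R by rewrite -ab a0 expr0n add0r.
have r0 : r != 0%R by rewrite invr_eq0 sqrtr_eq0 -ltNge.
have rb : (r ^+ 2 + (r * b) ^+ 2 = 1)%R by rewrite exprMn b2 mulr1 r2; field.
have e1 : (fun z : T * T => f (r * z.1 + r * b * z.2, - (r * b) * z.1 + r * z.2)%R) =
    fun z => f ((r * z.1 + r * b * z.2 + 0, - (r * b) * z.1 + r * z.2 + 0)%R).
  by apply/funext => z; rewrite !addr0.
have -> := ge0_integral_rot_neq0 r0 rb mf f0.
have mf1 : measurable_fun setT
    (fun z : T * T => f (r * z.1 + r * b * z.2, - (r * b) * z.1 + r * z.2)%R).
  rewrite e1; apply: (measurableT_comp mf).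
  by apply/measurable_fun_pair; exact: measurable_affine2.
have /= -> := ge0_integral_rot_neq0 r0 rb mf1 (fun=> f0 _).
apply: eq_integral => x _; apply: eq_integral => y _ /=; congr f; congr pair.
- transitivity (r ^+ 2 * (1 - b ^+ 2) * x + 2 * r ^+ 2 * b * y)%R; first by ring.
  by rewrite r2 b2 a0; field.
- transitivity (r ^+ 2 * (1 - b ^+ 2) * y - 2 * r ^+ 2 * b * x)%R; first by ring.
  by rewrite r2 b2 a0; field.
Qed.

End rotation.

(** * Linear images of the standard Gaussian law *)

Section matrix_measurability.
Context {R : realType} d (S : measurableType d).

Lemma measurable_addmx m n (f g : S -> 'M[R]_(m, n)) :
  measurable_fun setT f -> measurable_fun setT g ->
  measurable_fun setT (fun x => f x + g x).
Proof.
move=> /measurable_fun_mxP mf /measurable_fun_mxP mg; apply/measurable_fun_mxP => i j.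
by under eq_fun do rewrite mxE; exact: measurable_funD.
Qed.

Lemma measurable_scalemx m n (f : S -> R) (g : S -> 'M[R]_(m, n)) :
  measurable_fun setT f -> measurable_fun setT g ->
  measurable_fun setT (fun x => f x *: g x).
Proof.
move=> mf /measurable_fun_mxP mg; apply/measurable_fun_mxP => i j.
by under eq_fun do rewrite mxE; exact: measurable_funM.
Qed.

Lemma measurable_mulmx m n p (A : 'M[R]_(m, n)) (f : S -> 'M[R]_(n, p)) :
  measurable_fun setT f -> measurable_fun setT (fun x => A *m f x).
Proof.
move=> /measurable_fun_mxP mf; apply/measurable_fun_mxP => i j.
under eq_fun do rewrite mxE.
by apply: measurable_sum => l; exact: measurable_funM.
Qed.

Lemma measurable_scalar_mx n (f : S -> R) :
  measurable_fun setT f -> measurable_fun setT (fun x => (f x)%:M : 'M[R]_n).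
Proof.
move=> mf; apply/measurable_fun_mxP => i j; under eq_fun do rewrite mxE.
by case: (i == j) => //=; apply: measurable_cst.
Qed.

Lemma measurable_col_mx m1 m2 n (f : S -> 'M[R]_(m1, n)) (g : S -> 'M[R]_(m2, n)) :
  measurable_fun setT f -> measurable_fun setT g ->
  measurable_fun setT (fun x => col_mx (f x) (g x)).
Proof.
move=> /measurable_fun_mxP mf /measurable_fun_mxP mg; apply/measurable_fun_mxP => i j.
under eq_fun do rewrite mxE.
by case: (fintype.split i) => k; [exact: mf|exact: mg].
Qed.

End matrix_measurability.

Section std_gaussian_theory.
Context {R : realType}.
Local Open Scope ereal_scope.
Notation T := (measurableTypeR R).
Notation N01 := (normal_prob (0 : R) 1).

Lemma measurable_preimageT d d' (S : measurableType d) (S' : measurableType d')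
  (f : S -> S') (B : set S') : measurable_fun setT f -> measurable B ->
  measurable [set x | B (f x)].
Proof. by move=> mf mB; rewrite -[X in measurable X]setTI; exact: mf. Qed.

Lemma integral_cst_probability d (S : measurableType d) (P : probability S R)
  (c : \bar R) : \int[P]_x c = c.
Proof.
have := @integral_cst _ _ _ P setT measurableT c.
by rewrite [X in _ * X](@probability_setT _ _ _ P) mule1.
Qed.

Lemma product_measure1_set d d' (S : measurableType d) (S' : measurableType d')
  (P : probability S R) (Q : probability S' R) (B : set (S * S')) :
  (P \x Q) B = \int[P]_x Q [set y | B (x, y)].
Proof.
apply: eq_integral => x _ /=; congr (Q _).
by apply/seteqP; split=> y; rewrite /xsection /= in_setE.
Qed.

Lemma measurable_fun_section d d' (S : measurableType d) (S' : measurableType d')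
  (Q : probability S' R) (B : set (S * S')) : measurable B ->
  measurable_fun setT (fun x => Q [set y | B (x, y)]).
Proof.
move=> mB; rewrite (_ : (fun x => _) = Q \o xsection B).
  exact: measurable_fun_xsection.
apply/funext => x /=; congr (Q _).
by apply/seteqP; split=> y; rewrite /xsection /= in_setE.
Qed.

Lemma std_gaussianS (n : nat) (B : set 'cV[R]_n.+1) :
  std_gaussian n.+1 B = \int[N01]_x std_gaussian n [set y | B (vcons (x, y))].
Proof.
rewrite -[LHS]/((N01 \x std_gaussian n) (@vcons R n @^-1` B)).
by rewrite product_measure1_set.
Qed.

End std_gaussian_theory.

Section linear_images.
Context {R : realType}.
Notation T := (measurableTypeR R).
Notation N01 := (normal_prob (0 : R) 1).

Lemma gram_ge0 m n (M : 'M[R]_(m, n)) (x : 'cV[R]_m) :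
  0 <= (x^T *m (M *m M^T) *m x) 0 0.
Proof.
rewrite mulmxA -mulmxA -[M^T *m x]trmxK trmx_mul trmxK mxE.
by apply: sumr_ge0 => i _; rewrite !mxE -expr2 sqr_ge0.
Qed.

Lemma cholesky_gram m n (M : 'M[R]_(m, n)) :
  cholesky (M *m M^T) *m (cholesky (M *m M^T))^T = M *m M^T.
Proof.
by apply: choleskyP; [rewrite trmx_mul trmxK|exact: gram_ge0].
Qed.

Lemma gram_eq0 m n (M : 'M[R]_(m, n)) : M *m M^T = 0 -> M = 0.
Proof.
move=> MM; apply/matrixP => i j; have /eqP := congr1 (fun S : 'M[R]_m => S i i) MM.
rewrite !mxE psumr_eq0 => [/allP/(_ j)|l _]; last by rewrite mxE -expr2 sqr_ge0.
by rewrite mem_index_enum mxE -expr2 sqrf_eq0 => /(_ isT)/eqP.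
Qed.

Lemma cholesky_block n (S : 'M[R]_(1 + n)) :
  let c := Num.sqrt (S 0 0) in
  let v := c^-1 *: dlsubmx S in
  cholesky (S : 'M[R]_(n.+1)) = block_mx c%:M 0 v (cholesky (drsubmx S - v *m v^T)).
Proof. by []. Qed.

(* A rotation of the plane of the new coordinate and the first one makes the
   new coordinate disappear from the first row. *)
Lemma cholesky_rank1_update k p (M : 'M[R]_(1 + k, p)) (m : 'cV[R]_(1 + k)) :
  exists (c r a b : R) (v w : 'cV[R]_k) (q : nat) (L : 'M[R]_(k, q)),
  let m' := a *: dsubmx m - b *: v in
  [/\ cholesky (M *m M^T : 'M[R]_(k.+1)) = block_mx c%:M 0 v (cholesky (L *m L^T)),
      cholesky (m *m m^T + M *m M^T : 'M[R]_(k.+1)) =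
        block_mx r%:M 0 w (cholesky (m' *m m'^T + L *m L^T)),
      a ^+ 2 + b ^+ 2 = 1, m 0 0 * a - c * b = 0 &
      m 0 0 * b + c * a = r /\ w = b *: dsubmx m + a *: v].
Proof.
have LL : (cholesky (M *m M^T : 'M[R]_(k.+1)) : 'M[R]_(1 + k)) *m
    (cholesky (M *m M^T : 'M[R]_(k.+1)) : 'M[R]_(1 + k))^T = M *m M^T.
  exact: (cholesky_gram (M : 'M[R]_(k.+1, p))).
move: (M *m M^T) LL => S; rewrite cholesky_block.
set c := Num.sqrt (S 0 0); set v := c^-1 *: dlsubmx S; set L := cholesky _.
rewrite tr_block_mx mulmx_block ?(trmx0, mulmx0, mul0mx, addr0, add0r) => LL.
have S00 : S 0 0 = c ^+ 2.
  transitivity (ulsubmx S 0 0); first by rewrite !mxE lshift0.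
  by rewrite -LL block_mxKul tr_scalar_mx -scalar_mxM mxE eqxx mulr1n -expr2.
have Sdl : dlsubmx S = c *: v.
  by rewrite -LL block_mxKdl tr_scalar_mx mul_mx_scalar.
have Sdr : drsubmx S = v *m v^T + L *m L^T by rewrite -LL block_mxKdr.
(* The Schur complement of [S] is the Gram matrix of [L], so the lower block is again the Cholesky
   factor of a Gram matrix and an induction can continue with [L] in place of [M]. *)
have LE : L = cholesky (L *m L^T) by rewrite {1}/L Sdr addrAC subrr add0r.
pose mu := m 0 0; pose u := dsubmx m; pose r := Num.sqrt (mu ^+ 2 + c ^+ 2).
have s0 : 0 <= mu ^+ 2 + c ^+ 2 by rewrite addr_ge0 ?sqr_ge0.
have r2 : r ^+ 2 = mu ^+ 2 + c ^+ 2 by rewrite sqr_sqrtr.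
have S'00 : (m *m m^T + S) 0 0 = mu ^+ 2 + c ^+ 2.
  by rewrite mxE S00 mxE big_ord1 mxE -expr2.
have S'dl : dlsubmx (m *m m^T + S) = mu *: u + c *: v.
  rewrite -Sdl; apply/colP => i; rewrite !mxE big_ord1 !mxE lshift0.
  by rewrite [m 0 0 * _]mulrC.
have S'dr : drsubmx (m *m m^T + S) = u *m u^T + (v *m v^T + L *m L^T).
  by rewrite -Sdr; apply/matrixP => i j; rewrite !mxE !big_ord1 !mxE.
have [a [b [ab rab rabE wE]]] : exists a b, [/\ a ^+ 2 + b ^+ 2 = 1,
    mu * a - c * b = 0, mu * b + c * a = r &
    r^-1 *: (mu *: u + c *: v) = b *: u + a *: v].
  (* For [r = 0] both [mu] and [c] vanish, and so does [v] because [c^-1 = 0]; the identity rotation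
     will do. *)
  have [r0|rn0] := eqVneq r 0.
    have := r2; rewrite r0 expr0n /= => /esym/eqP.
    rewrite paddr_eq0 ?sqr_ge0// !expf_eq0 /= => /andP[/eqP mu0 /eqP c0].
    exists 1, 0; rewrite mu0 c0 /v c0 invr0 !scale0r !scaler0 addr0.
    by split; rewrite ?(mul0r, subrr, addr0, expr1n, expr0n)//= ?addr0.
  (* [(mu, c) / r] is the direction along which the first row varies; the rotation turns it into the
     second axis. *)
  exists (c / r), (mu / r); split.
  - by rewrite !expr_div_n -mulrDl addrC -r2 divff// expf_neq0.
  - by ring.
  - by rewrite -[RHS](mulfK rn0) -expr2 r2; ring.
  - by rewrite scalerDr !scalerA ![r^-1 * _]mulrC.
exists c, r, a, b, v, (b *: u + a *: v), k, L => m'; split=> //.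
  by rewrite -LE.
rewrite cholesky_block S'00 -/r S'dl wE S'dr.
(* [m'] and [b *: u + a *: v] form a rotation of the pair [(u, v)], so the sum of the two outer
   products is unchanged. *)
suff -> : u *m u^T + (v *m v^T + L *m L^T) - (b *: u + a *: v) *m (b *: u + a *: v)^T =
    m' *m m'^T + L *m L^T by [].
rewrite /m' -/u; clearbody L u v; move: (L *m L^T) => K.
apply/matrixP => i j; rewrite !mxE !big_ord1 !mxE; apply/eqP; rewrite -subr_eq0; apply/eqP.
transitivity ((1 - (a ^+ 2 + b ^+ 2)) * (u i 0 * u j 0 + v i 0 * v j 0)).
  by ring.
by rewrite ab subrr mul0r.
Qed.

Local Open Scope ereal_scope.

(** Induction on the dimension. After the rotation the first row involves [y] alone; with [y] fixed,
    the other rows have the shape of the statement one dimension lower, with column [m'] and factor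
    [L]. *)
Lemma std_gaussian_cholesky_update k p (M : 'M[R]_(k, p)) (m : 'cV[R]_k)
    (B : set 'cV[R]_k) : measurable B ->
  \int[N01]_x std_gaussian k [set y | B (x *: m + cholesky (M *m M^T) *m y)%R] =
  std_gaussian k [set y | B (cholesky (m *m m^T + M *m M^T)%R *m y)].
Proof.
elim: k p M m B => [|k IH] p M m B mB.
  have E (z : 'cV[R]_0) : B z = B 0%R by rewrite [z]flatmx0.
  have -> : [set y | B (cholesky (m *m m^T + M *m M^T)%R *m y)] = [set y | B 0%R].
    by apply/seteqP; split=> y /=; rewrite E.
  under eq_integral => x _.
    have -> : [set y | B (x *: m + cholesky (M *m M^T) *m y)%R] = [set y | B 0%R].
      by apply/seteqP; split=> y /=; rewrite E.
    over.
  exact: integral_cst_probability.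
rewrite -[k.+1]/(1 + k)%N in M m B mB *.
have [c [r [a [b [v [w [q [L]]]]]]]] := cholesky_rank1_update M m.
set u := dsubmx m; set m' := (a *: u - b *: v)%R.
move=> /= [-> -> ab e1 [e2 wE]].
pose F (z : T * T) := std_gaussian k [set y | B (col_mx
  (m 0 0 * z.1 + c * z.2)%:M
  (z.1 *: u + (z.2 *: v + cholesky (L *m L^T) *m y)))%R].
pose H (z : T * T) := std_gaussian k [set y | B (col_mx (r * z.2)%:M
  (z.1 *: m' + (z.2 *: w + cholesky (L *m L^T) *m y)))%R].
have mFH (p1 p2 : R) (q1 q2 : 'cV[R]_k) : measurable_fun setT
    (fun z : T * T => std_gaussian k [set y | B (col_mx (p1 * z.1 + p2 * z.2)%:M
      (z.1 *: q1 + (z.2 *: q2 + cholesky (L *m L^T) *m y)))%R]).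
  pose g (z : (T * T) * 'cV[R]_k) := (col_mx (p1 * z.1.1 + p2 * z.1.2)%:M
      (z.1.1 *: q1 + (z.1.2 *: q2 + cholesky (L *m L^T) *m z.2)))%R.
  apply: (@measurable_fun_section _ _ _ _ _ (std_gaussian k) [set z | B (g z)]).
  have m1 : measurable_fun setT (fun z : (T * T) * 'cV[R]_k => z.1.1 : R).
    exact: (measurableT_comp measurable_fst measurable_fst).
  have m2 : measurable_fun setT (fun z : (T * T) * 'cV[R]_k => z.1.2 : R).
    exact: (measurableT_comp measurable_snd measurable_fst).
  apply: measurable_preimageT => //; apply: measurable_col_mx.
    by apply: measurable_scalar_mx; apply: measurable_funD; exact: measurable_funM.
  apply: measurable_addmx; first exact: measurable_scalemx.
  by apply: measurable_addmx; [exact: measurable_scalemx|exact: measurable_mulmx].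
have mF : measurable_fun setT F by exact: mFH.
have mH : measurable_fun setT H.
  have := mFH 0%R r m' w; congr (measurable_fun _ _); apply/funext => z.
  by rewrite mul0r add0r.
have F0 z : 0 <= F z by [].
have H0 z : 0 <= H z by [].
transitivity (\int[N01]_x \int[N01]_y F (x, y)).
  apply: eq_integral => x _; rewrite [LHS](std_gaussianS (n := k)); apply: eq_integral => y _.
  congr (std_gaussian k _); apply/seteqP.
  suff E z : (x *: m + block_mx c%:M 0 v (cholesky (L *m L^T)) *m vcons (y, z))%R =
     (col_mx (m 0 0 * x + c * y)%:M (x *: u + (y *: v + cholesky (L *m L^T) *m z)))%R.
    by split=> z /=; rewrite -E.
  rewrite /vcons mul_block_col -{1}[m]vsubmxK [usubmx m]mx11_scalar scale_col_mx add_col_mx.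
  rewrite mul0mx addr0 -scalar_mxM scale_scalar_mx -raddfD /= mul_mx_scalar.
  by rewrite mxE lshift0 [(x * _)%R]mulrC.
rewrite (ge0_integral_std_normal_rot ab mF F0).
transitivity (\int[N01]_x \int[N01]_y H (x, y)).
  apply: eq_integral => x _; apply: eq_integral => y _; congr (std_gaussian k _).
  suff E z : (col_mx (m 0 0 * (a * x + b * y) + c * (- b * x + a * y))%:M
      ((a * x + b * y) *: u + ((- b * x + a * y) *: v + cholesky (L *m L^T) *m z)))%R =
     (col_mx (r * y)%:M (x *: m' + (y *: w + cholesky (L *m L^T) *m z)))%R.
    by apply/seteqP; split=> z /=; rewrite -E.
  congr col_mx.
    congr (_%:M)%R; transitivity ((m 0 0 * a - c * b) * x + (m 0 0 * b + c * a) * y)%R.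
      by ring.
    by rewrite e1 e2 mul0r add0r.
  rewrite !addrA; congr (_ + _)%R; rewrite wE /m'; clearbody u.
  by apply/colP => i; rewrite !mxE; ring.
(* The induction hypothesis integrates over the coordinate [x] to be absorbed, at fixed [y]; so [y]
   moves outside. *)
rewrite (@fubini_tonelli _ _ _ _ _ N01 N01 H mH H0).
rewrite [RHS](std_gaussianS (n := k)); apply: eq_integral => y _.
transitivity (std_gaussian k [set z | B (col_mx (r * y)%:M
    (y *: w + cholesky (m' *m m'^T + L *m L^T) *m z))%R]); last first.
  congr (std_gaussian k _); apply/seteqP.
  suff E z : (block_mx r%:M 0 w (cholesky (m' *m m'^T + L *m L^T)) *m vcons (y, z))%R =
     (col_mx (r * y)%:M (y *: w + cholesky (m' *m m'^T + L *m L^T) *m z))%R.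
    by split=> z /=; rewrite -E.
  by rewrite /vcons mul_block_col mul0mx addr0 -scalar_mxM mul_mx_scalar.
have := IH q L m' [set z | B (col_mx (r * y)%:M (y *: w + z))%R].
have -> : (fun x => std_gaussian k
   [set y0 | [set z | B (col_mx (r * y)%:M (y *: w + z))%R] (x *: m' + cholesky (L *m L^T) *m y0)%R]) =
   (fun x => H (x, y)).
  apply/funext => x; congr (std_gaussian k _); apply/seteqP.
  by split=> z /=; rewrite addrCA.
apply; apply: measurable_preimageT => //.
apply: measurable_col_mx => //; exact: measurable_addmx.
Qed.

Lemma std_gaussian_mulmx k p (M : 'M[R]_(k, p)) (B : set 'cV[R]_k) : measurable B ->
  std_gaussian p [set y | B (M *m y)] = gaussian (M *m M^T)%R B.
Proof.
have gE (S : 'M[R]_k) B' : gaussian S B' = std_gaussian k [set y | B' (cholesky S *m y)%R].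
  by [].
elim: p M B => [|p IH] M B mB.
  (* Without columns both images are the point mass at 0, as [cholesky 0] has zero Gram matrix. *)
  rewrite gE [M]thinmx0 mul0mx (_ : cholesky 0 = 0)%R; last first.
    by apply: gram_eq0; have := cholesky_gram (0 : 'M[R]_k); rewrite mul0mx.
  suff E q : std_gaussian q [set y | B ((0 : 'M[R]_(k, q)) *m y)] =
      if `[< B 0%R >] then 1 else 0 by rewrite !E.
  case: asboolP => B0.
    rewrite (_ : [set y | _] = setT); first exact: probability_setT.
    by apply/seteqP; split=> y //=; rewrite mul0mx.
  rewrite (_ : [set y | _] = set0); first exact: measure0.
  by apply/seteqP; split=> y //=; rewrite mul0mx.
rewrite -[p.+1]/(1 + p)%N in M *; set m := lsubmx M; set M' := rsubmx M.
have ME : M = row_mx m M' by rewrite hsubmxK.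
rewrite gE [X in cholesky X](_ : _ = m *m m^T + M' *m M'^T)%R; last first.
  by rewrite ME tr_row_mx mul_row_col.
rewrite -std_gaussian_cholesky_update// [LHS](std_gaussianS (n := p)).
apply: eq_integral => x _.
rewrite -[RHS](gE _ [set z | B (x *: m + z)%R]) -IH; last first.
  by apply: measurable_preimageT => //; exact: measurable_addmx.
congr (std_gaussian p _); apply/seteqP.
suff E z : (M *m vcons (x, z) = x *: m + M' *m z)%R by split=> z /=; rewrite E.
by rewrite ME /vcons mul_row_col mul_mx_scalar.
Qed.

Lemma eq_std_gaussian_mulmx k p q (M : 'M[R]_(k, p)) (N : 'M[R]_(k, q))
    (B : set 'cV[R]_k) : measurable B -> (M *m M^T = N *m N^T)%R ->
  std_gaussian p [set y | B (M *m y)] = std_gaussian q [set y | B (N *m y)].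
Proof. by move=> mB MN; rewrite !std_gaussian_mulmx// MN. Qed.

End linear_images.

(** * Product structure of the standard Gaussian law *)

Section gaussian_products.
Context {R : realType}.
Local Open Scope ereal_scope.
Notation T := (measurableTypeR R).
Notation N01 := (normal_prob (0 : R) 1).

Lemma ge0_integral_std_gaussianS n (f : 'cV[R]_n.+1 -> \bar R) :
  measurable_fun setT f -> (forall x, 0 <= f x) ->
  \int[std_gaussian n.+1]_x f x =
  \int[N01]_x \int[std_gaussian n]_y f (vcons (x, y)).
Proof.
move=> mf f0; rewrite -[LHS]/(\int[pushforward (N01 \x std_gaussian n) (@vcons R n)]_x f x).
rewrite (ge0_integral_distribution (P := (N01 \x std_gaussian n)%E) (@vcons R n))//.
have mfv : measurable_fun setT (f \o @vcons R n) by exact: measurableT_comp.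
exact: (@fubini_tonelli1 _ _ _ _ _ N01 (std_gaussian n) _ mfv (fun=> f0 _)).
Qed.

Lemma std_gaussianD a b (B : set 'cV[R]_(a + b)) : measurable B ->
  std_gaussian (a + b) B = \int[std_gaussian a]_x std_gaussian b [set y | B (col_mx x y)].
Proof.
elim: a B => [|a IH] B mB.
  transitivity (\int[\d_(0%R : 'cV[R]_0)]_x std_gaussian b [set y | B (col_mx x y)]);
    last by [].
  rewrite integral_dirac//; last first.
    apply: (@measurable_fun_section _ _ _ _ _ (std_gaussian b) [set z | B (col_mx z.1 z.2)]).
    by apply: measurable_preimageT => //; exact: measurable_col_mx.
  rewrite diracT mul1e; congr (std_gaussian b _).
  by apply/seteqP; split=> y /=; rewrite col_flat_mx.
rewrite [LHS](std_gaussianS (n := a + b)) ge0_integral_std_gaussianS//; last first.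
  apply: (@measurable_fun_section _ _ _ _ _ (std_gaussian b) [set z | B (col_mx z.1 z.2)]).
  by apply: measurable_preimageT => //; exact: measurable_col_mx.
apply: eq_integral => x _; rewrite (IH [set y | B (vcons (x, y))]); last first.
  apply: measurable_preimageT => //.
  exact: (measurableT_comp (@measurable_vcons R (a + b)) (pair1_measurable x)).
apply: eq_integral => y _; congr (std_gaussian b _).
suff E z : vcons (x, col_mx y z) = col_mx (vcons (x, y)) z :> 'cV[R]_(a + b).+1.
  by apply/seteqP; split=> z /=; rewrite E.
by rewrite /vcons /= col_mxA castmx_id.
Qed.

(** The products over the orders above [p] originate here. *)
Lemma std_gaussian_box n (S : 'I_n -> set T) : (forall i, measurable (S i)) ->
  std_gaussian n [set y | forall i, S i (y i 0%R)] = (\prod_i fine (N01 (S i)))%:E.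
Proof.
elim: n S => [|n IH] S mS.
  by rewrite big_ord0 (_ : [set y | _] = setT) ?probability_setT//; apply/seteqP; split=> // y _ [].
pose S' (i : 'I_n) := S (lift ord0 i).
have -> : std_gaussian n.+1 [set y | forall i, S i (y i 0%R)] =
    (N01 \x std_gaussian n) (S ord0 `*` [set y : 'cV[R]_n | forall i, S' i (y i 0%R)]).
  transitivity ((N01 \x std_gaussian n) (@vcons R n @^-1` [set y | forall i, S i (y i 0%R)])).
    by [].
  congr ((N01 \x std_gaussian n) _).
  have E0 (x : T) (y : 'cV[R]_n) : vcons (x, y) ord0 0%R = x.
    transitivity (col_mx (x%:M : 'M[R]_1) y (lshift n ord0) 0)%R.
      by rewrite /vcons; congr (col_mx _ _ _ _); exact/val_inj.
    by rewrite col_mxEu mxE eqxx.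
  have ES (x : T) (y : 'cV[R]_n) i : vcons (x, y) (lift ord0 i) 0%R = y i 0%R.
    transitivity (col_mx (x%:M : 'M[R]_1) y (rshift 1 i) 0)%R; last by rewrite col_mxEd.
    by rewrite /vcons; congr (col_mx _ _ _ _); exact/val_inj.
  apply/seteqP; split=> -[x y] /=.
    by move=> H; split=> [|i]; [rewrite -(E0 x y)|rewrite /S' -(ES x)].
  move=> [H0 HS] i; case: (unliftP ord0 i) => [j|] ->; last by rewrite E0.
  by rewrite ES; exact: HS.
have mS' : measurable [set y : 'cV[R]_n | forall i, S' i (y i 0%R)].
  have -> : [set y : 'cV[R]_n | forall i, S' i (y i 0%R)] =
      \bigcap_(i in [set: 'I_n]) [set y : 'cV[R]_n | S' i (y i 0%R)].
    by apply/seteqP; split=> y /= H; [move=> i _|move=> i]; apply: H.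
  apply: fin_bigcap_measurable => // i _.
  by apply: (measurable_preimageT (measurable_mx_entry i 0%R)); exact: mS.
rewrite product_measure1E//.
rewrite [X in _ * X](IH S' (fun i => mS _)) big_ord_recl EFinM fineK//; exact: fin_num_measure.
Qed.

(** Scaling a standard variable covers [s = 0] as well, so that a vanishing [zeta] needs no case
    distinction later. *)
Lemma normal0E (s : R) (B : set T) : measurable B ->
  normal0 s B = N01 [set x | B (s * x)%R].
Proof.
move=> mB; rewrite /normal0; have [->|s0] := eqVneq s 0%R.
  rewrite diracE; have [B0|B0] := pselect (B 0%R).
    rewrite (_ : [set x | _] = setT); last by apply/seteqP; split=> x //=; rewrite mul0r.
    by rewrite mem_set// [RHS]probability_setT.
  rewrite (_ : [set x | _] = set0); last by apply/seteqP; split=> x //=; rewrite mul0r.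
  by rewrite memNset// measure0.
have mB' : measurable [set x : T | B (s * x)%R].
  by apply: measurable_preimageT => //; exact: mulrl_measurable.
rewrite /normal_prob integral_mkcond (@ge0_integral_affine R s 0)//; last 2 first.
- apply/(measurable_restrictT _ _).1 => //; apply/measurable_funTS/measurable_EFinP.
  exact: measurable_normal_pdf.
- by move=> x; apply: erestrict_ge0 => y _; rewrite lee_fin normal_pdf_ge0.
rewrite [RHS]integral_mkcond -ge0_integralZl//; last 2 first.
- apply: measurableT_comp (measurable_affine s 0).
  apply/(measurable_restrictT _ _).1 => //; apply/measurable_funTS/measurable_EFinP.
  exact: measurable_normal_pdf.
- by move=> x _; apply: erestrict_ge0 => y _; rewrite lee_fin normal_pdf_ge0.
apply: eq_integral => x _; rewrite !patchE addr0.
have -> : ((s * x)%R \in B) = (x \in [set x | B (s * x)%R]).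
  by apply/idP/idP; rewrite !inE.
case: ifP => _; last by rewrite mule0.
rewrite -EFinM !normal_pdfE ?oner_eq0// /normal_fun !subr0; congr EFin.
rewrite mulrA; congr (_ * expR _)%R.
  rewrite /normal_peak -!mulrnAr expr1n mul1r sqrtrM ?sqr_ge0// sqrtr_sqr.
  by rewrite invfM mulrA divff ?normr_eq0// mul1r.
by rewrite exprMn; field.
Qed.

Lemma Delta_std_normal (s a b : R) :
  Delta s a b = fine (N01 [set x | `|s * x - a| < b]%R).
Proof.
rewrite /Delta normal0E//.
rewrite (_ : [set x | _] = (fun x : T => `|x - a|%R) @^-1` `]-oo, b[%classic); last first.
  by apply/seteqP; split=> x /=; rewrite in_itv.
apply: measurable_preimageT => //.
by apply: (measurableT_comp (@normr_measurable R setT)); exact: measurable_funB.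
Qed.

End gaussian_products.

(** * Orthogonal decomposition of the design *)

Section triangular_factors.
Context {R : realType}.

Lemma gram_unit m n (M : 'M[R]_(m, n)) : row_free M -> M *m M^T \in unitmx.
Proof.
move=> freeM; rewrite -row_free_unit; apply: inj_row_free => v vMM.
have vM : v *m M = 0.
  apply: gram_eq0; rewrite trmx_mul -mulmxA (mulmxA M) (mulmxA v) vMM mul0mx //.
by apply: (row_free_inj freeM); rewrite vM mul0mx.
Qed.

Lemma cholesky_trig n (S : 'M[R]_n) (i j : 'I_n) :
  (i < j)%N -> cholesky S i j = 0.
Proof.
elim: n S i j => [_ []//|n IH] S i j.
rewrite -[n.+1]/(1 + n)%N in S i j *; rewrite cholesky_block.
case: (fintype.splitP i) => i' iE; case: (fintype.splitP j) => j' jE.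
- by move=> ij; exfalso; move: ij; rewrite iE jE !ord1 ltnn.
- move=> _; have -> : i = lshift n i' by exact/val_inj.
  have -> : j = rshift 1 j' by exact/val_inj.
  by rewrite block_mxEur mxE.
- by move=> ij; exfalso; move: ij; rewrite iE jE (ord1 j') ltn0.
- rewrite iE jE ltn_add2l => ij; have -> : i = rshift 1 i' by exact/val_inj.
  have -> : j = rshift 1 j' by exact/val_inj.
  by rewrite block_mxEdr IH.
Qed.

Lemma cholesky_diag_ge0 n (S : 'M[R]_n) (i : 'I_n) : 0 <= cholesky S i i.
Proof.
elim: n S i => [_ []//|n IH] S i.
rewrite -[n.+1]/(1 + n)%N in S i *; rewrite cholesky_block.
case: (fintype.splitP i) => i' iE.
- have -> : i = lshift n i' by exact/val_inj.
  by rewrite block_mxEul !ord1 mxE eqxx mulr1n sqrtr_ge0.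
- have -> : i = rshift 1 i' by exact/val_inj.
  by rewrite block_mxEdr IH.
Qed.

(** The equality of dimensions is a hypothesis because [P + (n - P)] and [n] are not convertible. *)
Lemma mulmx1_tr m n (W : 'M[R]_(m, n)) : n = m -> W^T *m W = 1%:M -> W *m W^T = 1%:M.
Proof. by move=> e; case: _ / e W => W; exact: mulmx1C. Qed.

(** Gram-Schmidt through Cholesky: [L *m L^T = M *m M^T] says that [invmx L *m M] has orthonormal
    rows. The diagonal of [L] is nonnegative, and its product is the nonzero determinant. *)
Lemma orthonormal_rows m n (M : 'M[R]_(m, n)) : row_free M ->
  exists L : 'M[R]_m, [/\ L *m L^T = M *m M^T, L \in unitmx,
    (forall i j : 'I_m, (i < j)%N -> L i j = 0), (forall i, 0 < L i i) &
    (invmx L *m M) *m (invmx L *m M)^T = 1%:M].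
Proof.
move=> freeM; exists (cholesky (M *m M^T)); set L := cholesky _.
have LL : L *m L^T = M *m M^T by exact: cholesky_gram.
have uL : L \in unitmx.
  by have := gram_unit freeM; rewrite -LL unitmx_mul => /andP[].
have tL (i j : 'I_m) : (i < j)%N -> L i j = 0 by exact: cholesky_trig.
split=> // [i|].
  rewrite lt_neqAle cholesky_diag_ge0 andbT eq_sym.
  have : \det L != 0 by rewrite -unitfE -unitmxE.
  rewrite det_trig; last by apply/is_trig_mxP => a b; exact: tL.
  by apply: contraNneq => Li0; rewrite (bigD1 i)//= Li0 mul0r.
rewrite trmx_mul trmx_inv -mulmxA (mulmxA M) -LL -mulmxA mulmxV ?unitmx_tr//.
by rewrite mulmx1 mulVmx.
Qed.

(* F is an orthonormal basis of the column space of X adapted to the flag of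
   the first columns, and E one of its orthogonal complement. *)
Lemma qr_decomposition n P (X : 'M[R]_(n, P)) : \rank X = P ->
  exists (F : 'M[R]_(n, P)) (U : 'M[R]_P) (E : 'M[R]_(n, n - P)),
  [/\ X = F *m U, U \in unitmx,
      (forall i j : 'I_P, (j < i)%N -> U i j = 0) /\ (forall i, 0 < U i i),
      [/\ F^T *m F = 1%:M, F^T *m E = 0 & E^T *m E = 1%:M] &
      F *m F^T + E *m E^T = 1%:M].
Proof.
move=> rX; have freeXT : row_free X^T by rewrite /row_free mxrank_tr rX.
have [L [LL uL tL dL LX]] := orthonormal_rows freeXT.
pose F := (invmx L *m X^T)^T.
have XF : X = F *m L^T.
  by rewrite /F trmx_mul trmxK trmx_inv -mulmxA mulVmx ?mulmx1// unitmx_tr.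
have FF : F^T *m F = 1%:M by rewrite /F trmxK.
have rK : \rank (kermx X) = (n - P)%N by rewrite mxrank_ker rX.
(* [kermx X] consists of the row vectors annihilated by [X], the orthogonal complement of its
   columns; a basis of it is orthonormalized, and [rK] identifies its size with [n - P]. *)
have [E [EE XE]] : exists E : 'M[R]_(n, n - P), E^T *m E = 1%:M /\ X^T *m E = 0.
  have freeK := row_base_free (kermx X).
  have [L' [_ _ _ _ LK]] := orthonormal_rows freeK.
  case: _ / rK; exists (invmx L' *m row_base (kermx X))^T; rewrite trmxK; split=> //.
  rewrite -trmx_mul -mulmxA; have /sub_kermxP -> : (row_base (kermx X) <= kermx X)%MS.
    by rewrite eq_row_base.
  by rewrite mulmx0 trmx0.
have FE : F^T *m E = 0 by rewrite /F trmxK -mulmxA XE mulmx0.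
clearbody F; exists F, L^T, E; split=> //.
- by rewrite unitmx_tr.
- by split=> [i j ji|i]; rewrite mxE; [exact: tL|exact: dL].
have EF : E^T *m F = 0 by rewrite -[LHS]trmxK trmx_mul trmxK FE trmx0.
rewrite -mul_row_col -tr_row_mx; apply: mulmx1_tr.
  by rewrite subnKC// -rX rank_leq_row.
by rewrite tr_row_mx mul_col_row FF FE EF EE -scalar_mx_block.
Qed.

(* The projection (regression) coefficient of x on the rows of N. *)
Lemma generalized_inverse_regression k p (N : 'M[R]_(k, p)) (x : 'cV[R]_p) (G : 'M[R]_k) :
  let S := N *m N^T in let b := (N *m x)^T *m G in
  generalized_inverse S G ->
  [/\ S *m b^T = N *m x, b *m S *m b^T = b *m (N *m x) &
      (b *m (N *m x)) 0 0 <= (x^T *m x) 0 0].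
Proof.
move=> S b; rewrite /generalized_inverse => SGS.
have ST : S^T = S by rewrite trmx_mul trmxK.
have SE : S = N *m N^T by []; have bE : b = (N *m x)^T *m G by [].
clearbody S b.
have SGS' : S *m G^T *m S = S by have := congr1 trmx SGS; rewrite !trmx_mul ST mulmxA.
(* [G] may be asymmetric, so its transpose is tracked. The Gram matrix of the difference vanishes by
   [S G S = S] and its transpose. *)
have SGN : S *m G^T *m N = N.
  apply/eqP; rewrite -subr_eq0; apply/eqP/gram_eq0.
  rewrite linearB /= !trmx_mul trmxK ST mulmxBl !mulmxBr.
  rewrite -!mulmxA (mulmxA N N^T) -SE !mulmxA SGS' SGS.
  by rewrite !subrr.
have bT : b^T = G^T *m N *m x by rewrite bE trmx_mul trmxK mulmxA.
have Sb : S *m b^T = N *m x by rewrite bT !mulmxA SGN.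
split=> //; first by rewrite -mulmxA Sb.
(* The inequality is the nonnegativity of the squared norm of the regression residual. *)
have : 0 <= ((x - N^T *m b^T)^T *m (x - N^T *m b^T)) 0 0.
  by rewrite mxE; apply: sumr_ge0 => i _; rewrite mxE -expr2 sqr_ge0.
have -> : (x - N^T *m b^T)^T = x^T - b *m N by rewrite linearB /= trmx_mul !trmxK.
rewrite mulmxBl !mulmxBr.
have -> : x^T *m (N^T *m b^T) = b *m (N *m x).
  transitivity ((b *m (N *m x))^T); first by rewrite !trmx_mul mulmxA.
  by rewrite [b *m (N *m x)]mx11_scalar tr_scalar_mx.
have -> : b *m N *m (N^T *m b^T) = b *m (N *m x).
  by rewrite -Sb SE !mulmxA.
by rewrite -(mulmxA b N x) subrr subr0 !mxE subr_ge0.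
Qed.

End triangular_factors.

(** * Restricted least squares in the adapted basis *)

Section selection_matrix.
Context {R : realType} (P : nat).
Implicit Types p : 'I_P.+1.

(** With this matrix, extracting columns, extracting components and padding by zeros are all matrix
    products. *)
Definition sel p : 'M[R]_(P, p) := fcols p 1%:M.

Lemma fcolsE m p (D : 'M[R]_(m, P)) : fcols p D = D *m sel p.
Proof. by rewrite /sel /fcols mulmx_colsub mulmx1. Qed.

Lemma tr_sel_mul m p (D : 'M[R]_(P, m)) i j :
  ((sel p)^T *m D) i j = D (widen_ord (leq_ord p) i) j.
Proof. by rewrite /sel /fcols trmx_mxsub trmx1 mul_rowsub_mx mul1mx mxE. Qed.

Lemma sel_mulE m p (D : 'M[R]_(p, m)) i j :
  (sel p *m D) i j = if insub (i : nat) is Some l then D l j else 0.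
Proof.
rewrite mxE; case: insubP => [l ip lE|ip].
  rewrite (bigD1 l)//= big1 => [|l' l'l]; rewrite !mxE -val_eqE /= -lE.
    by rewrite eqxx mul1r addr0.
  by rewrite eq_sym val_eqE (negbTE l'l) mul0r.
rewrite big1// => l _; rewrite !mxE -val_eqE /=.
by case: eqP => [il|]; [rewrite il ltn_ord in ip|rewrite mul0r].
Qed.

Lemma tr_sel_sel p : (sel p)^T *m sel p = 1%:M.
Proof. by apply/matrixP => i j; rewrite tr_sel_mul !mxE. Qed.

Lemma sel_max : sel ord_max *m (sel ord_max)^T = 1%:M.
Proof. exact: (mulmx1_tr erefl (tr_sel_sel ord_max)). Qed.

Lemma zero_padE p (y : 'cV[R]_p) : zero_pad P y = sel p *m y.
Proof. by apply/colP => i; rewrite sel_mulE mxE. Qed.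

Lemma coordinateS (x : 'cV[R]_P) (i : 'I_P) : coordinate x i.+1 = x i 0.
Proof.
rewrite /coordinate /entry /= (insubT (fun k => k < P)%N (ltn_ord i)).
rewrite insubT//=; congr (x _ _); exact/val_inj.
Qed.

Lemma mulmx_split m p (D : 'M[R]_(m, P)) (x : 'cV[R]_P) :
  D *m x = fcols p D *m frows p x + lcols p D *m lrows p x.
Proof.
apply/matrixP => i j; rewrite !mxE.
rewrite (reindex (cast_ord (subnKC (leq_ord p)))) /=; last first.
  by apply: onW_bij; exact: (Bijective (cast_ordK _) (cast_ordKV _)).
rewrite big_split_ord /=; congr (_ + _); apply: eq_bigr => l _; rewrite !mxE.
  by congr (D i _ * x _ j); exact/val_inj.
by [].
Qed.

End selection_matrix.

Lemma invmxM {R : comUnitRingType} n (A B : 'M[R]_n) :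
  A \in unitmx -> B \in unitmx -> invmx (A *m B) = invmx B *m invmx A.
Proof.
move=> uA uB; have uAB : A *m B \in unitmx by rewrite unitmx_mul uA.
by rewrite -[RHS](mulmxK uAB) !mulmxA mulmxKV// mulVmx// mul1mx.
Qed.

Section linear_model_algebra.
Context {R : realType} (n P : nat) (X F : 'M[R]_(n, P)) (U : 'M[R]_P).
Context (XE : X = F *m U) (FF : F^T *m F = 1%:M) (uU : U \in unitmx)
  (tU : forall i j : 'I_P, (j < i)%N -> U i j = 0) (dU : forall i, 0 < U i i).
Context (n_gt0 : (0 < n)%N).
Implicit Types p q : 'I_P.+1.
Local Notation sel := (@sel R P).
Local Notation sn := (Num.sqrt (n%:R : R)).

(** The leading block of [U], locked so that rewriting treats it as an atom. *)
Let Up p : 'M[R]_p := locked ((sel p)^T *m U *m sel p).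

Let UpE p : Up p = (sel p)^T *m U *m sel p.
Proof. by rewrite /Up -lock. Qed.

(** An upper triangular [U] preserves the span of the first [p] basis vectors. Hence a single [F]
    factors [X[p]] for all orders at once. *)
Let U_sel p : U *m sel p = sel p *m Up p.
Proof.
apply/matrixP => i j; rewrite sel_mulE -fcolsE mxE.
case: insubP => [l lp lE|ip].
  by rewrite UpE -mulmxA tr_sel_mul -fcolsE mxE; congr (U _ _); exact/val_inj.
by rewrite tU//= (leq_trans (ltn_ord j))// leqNgt.
Qed.

Let uUp p : Up p \in unitmx.
Proof.
have /mulmx1_unit[] // : ((sel p)^T *m invmx U *m sel p) *m Up p = 1%:M.
by rewrite -mulmxA -U_sel !mulmxA mulmxKV// tr_sel_sel.
Qed.

Let fcolsX p : fcols p X = F *m sel p *m Up p.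
Proof. by rewrite fcolsE XE -!mulmxA U_sel. Qed.

Let gramX p : (fcols p X)^T *m fcols p X = (Up p)^T *m Up p.
Proof.
rewrite fcolsX !trmx_mul -!mulmxA; congr (_ *m _).
by rewrite (mulmxA F^T) FF mul1mx (mulmxA (sel p)^T) tr_sel_sel mul1mx.
Qed.

Let pinvX p : invmx ((fcols p X)^T *m fcols p X) *m (fcols p X)^T =
  invmx (Up p) *m (sel p)^T *m F^T.
Proof.
rewrite gramX invmxM ?unitmx_tr// fcolsX !trmx_mul -!mulmxA.
by rewrite mulKmx// unitmx_tr.
Qed.

Lemma theta_tildeE p (u : 'cV[R]_n) :
  theta_tilde X p u = sel p *m (invmx (Up p) *m ((sel p)^T *m (F^T *m u))).
Proof. by rewrite /theta_tilde pinvX zero_padE !mulmxA. Qed.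

Lemma theta_tildeD p (u v : 'cV[R]_n) :
  theta_tilde X p (u + v) = theta_tilde X p u + theta_tilde X p v.
Proof. by rewrite !theta_tildeE !mulmxDr. Qed.

Lemma eta_nE p (theta : 'cV[R]_P) : eta_n X theta p = theta_tilde X p (X *m theta).
Proof.
rewrite /eta_n /theta_tilde; congr zero_pad.
rewrite (mulmx_split p) mulmxDr !mulmxA; congr (_ + _).
by rewrite -(mulmxA (invmx _)) mulVmx ?mul1mx// gramX unitmx_mul unitmx_tr uUp.
Qed.

Lemma residualE (theta : 'cV[R]_P) (u : 'cV[R]_n) :
  (X *m theta + u) - X *m theta_tilde X ord_max (X *m theta + u) = u - F *m (F^T *m u).
Proof.
have XT v : X *m theta_tilde X ord_max v = F *m (F^T *m v).
  rewrite theta_tildeE mulmxA -fcolsE fcolsX -!mulmxA (mulmxA (Up _)) mulmxV// mul1mx.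
  by rewrite (mulmxA (sel _)) sel_max mul1mx.
rewrite XT mulmxDr mulmxDr opprD addrACA XE -(mulmxA F) (mulmxA F^T) FF mul1mx.
by rewrite mulmxA subrr add0r.
Qed.

Let inv_gramE p : inv_gram X p = (sn *: invmx (Up p)) *m (sn *: invmx (Up p))^T.
Proof.
have n0 : (n%:R : R) != 0 by rewrite pnatr_eq0 -lt0n.
rewrite /inv_gram gramX invmxZ; last first.
  by rewrite unitmxZ ?unitfE ?invr_eq0// unitmx_mul unitmx_tr uUp.
rewrite invrK invmxM ?unitmx_tr// -trmx_inv linearZ /= -scalemxAr -scalemxAl scalerA.
by rewrite -expr2 sqr_sqrtr.
Qed.

(** The last row of an upper triangular matrix is its pivot times the last unit vector, so the last
    row of the inverse has the reciprocal there. This is why the [p]-th statistic sees a single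
    coordinate of [F^T *m u]. *)
Let row_last p (i : 'I_P) (l : 'I_p) : p = i.+1 :> nat -> l = i :> nat ->
  row l (invmx (Up p)) = (U i i)^-1 *: delta_mx 0 l.
Proof.
move=> pi li; have U0 : U i i != 0 by rewrite gt_eqF.
have row_Up : row l (Up p) = U i i *: delta_mx 0 l.
  apply/rowP => j; rewrite UpE mxE -mulmxA tr_sel_mul -fcolsE !mxE eqxx /= -val_eqE /=.
  case: eqP => [jl|/eqP jl].
    by rewrite mulr1; congr (U _ _); apply/val_inj; rewrite /= ?jl.
  rewrite mulr0 tU//=; have := ltn_ord j.
  by rewrite [X in (_ < X)%N]pi ltnS leq_eqVlt -li (negbTE jl).
have : row l (Up p) *m invmx (Up p) = delta_mx 0 l by rewrite -row_mul mulmxV// row1.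
rewrite row_Up -scalemxAl -rowE => <-.
by rewrite scalerA mulVf// scale1r.
Qed.

Lemma xiE p (i : 'I_P) : p = i.+1 :> nat -> xi X p = sn / U i i.
Proof.
move=> pi; have ip : (i < p)%N by rewrite pi.
pose l := Ordinal ip.
have pi1 : p.-1 = i by rewrite pi.
rewrite /xi /entry pi1 (insubT (fun k => k < p)%N ip) -/l inv_gramE.
have -> : ((sn *: invmx (Up p)) *m (sn *: invmx (Up p))^T) l l =
   (row l (sn *: invmx (Up p)) *m (row l (sn *: invmx (Up p)))^T) 0 0.
  by rewrite !mxE; apply: eq_bigr => j _; rewrite !mxE.
rewrite linearZ /= (@row_last p i l)// scalerA linearZ /= -scalemxAr -scalemxAl scalerA.
rewrite trmx_delta mul_delta_mx mxE mxE !eqxx mulr1 -expr2 sqrtr_sqr ger0_norm//.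
by rewrite divr_ge0// ltW.
Qed.

Lemma xi_gt0 p (i : 'I_P) : p = i.+1 :> nat -> 0 < xi X p.
Proof. by move=> pi; rewrite (xiE pi) divr_gt0// sqrtr_gt0 ltr0n. Qed.

Lemma xi0 p : p = 0%N :> nat -> xi X p = 0.
Proof.
move=> p0; rewrite /xi /entry /=; case: insubP => [l|]; last by rewrite sqrtr0.
by have := ltn_ord l; rewrite [X in (_ < X)%N]p0.
Qed.

Lemma coordinate_theta_tilde p (i : 'I_P) u : p = i.+1 :> nat ->
  sn * coordinate (theta_tilde X p u) p = xi X p * (F^T *m u) i 0.
Proof.
move=> pi; have ip : (i < p)%N by rewrite pi.
pose l := Ordinal ip.
rewrite [X in coordinate _ X]pi coordinateS theta_tildeE sel_mulE (insubT (fun k => k < p)%N ip) -/l.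
set z := _ *m (F^T *m u).
have -> : (invmx (Up p) *m z) l 0 = (row l (invmx (Up p)) *m z) 0 0.
  by rewrite -row_mul [RHS]mxE.
rewrite (@row_last p i l)// -scalemxAl -rowE mxE [row l z _ _]mxE tr_sel_mul (xiE pi) mulrA.
by congr (_ * (F^T *m u) _ _); exact/val_inj.
Qed.

(** The centred [p]-th numerator is the inner product of [xi X p *: last_basis p] with the first [p]
    coordinates. So [lin_cov] and [C_vec] are, up to [sigma ^+ 2], the covariance of the target and
    its covariance with that numerator, in the form the regression lemma takes. *)
Lemma linear_target k (A : 'M[R]_(k, P)) p :
  exists M : 'M[R]_(k, p), [/\ lin_cov X A p = M *m M^T,
    C_vec X A p = M *m (xi X p *: last_basis p) &
    forall u, sn *: (A *m theta_tilde X p u) = M *m ((sel p)^T *m (F^T *m u))].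
Proof.
exists (fcols p A *m (sn *: invmx (Up p))); split.
- by rewrite /lin_cov inv_gramE trmx_mul !mulmxA.
- rewrite /C_vec inv_gramE -!mulmxA; congr (_ *m (_ *m _)).
  case: (posnP p) => [p0|p_gt0].
    by apply/colP => l; have := ltn_ord l; rewrite [X in (_ < X)%N]p0.
  have iP : (p.-1 < P)%N by rewrite prednK// -ltnS ltn_ord.
  have lp : (p.-1 < p)%N by rewrite prednK.
  pose i := Ordinal iP; pose l := Ordinal lp.
  have pi : p = i.+1 :> nat by rewrite /= prednK.
  have -> : last_basis p = (delta_mx 0 l)^T :> 'cV[R]_p.
    by apply/colP => j; rewrite !mxE eqxx /= -val_eqE /= [X in _ == X]pi eqSS.
  rewrite -trmx_mul -rowE linearZ /= (@row_last p i l)// scalerA -(xiE pi).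
  by rewrite linearZ.
- move=> u; rewrite theta_tildeE mulmxA -fcolsE -!mulmxA scalemxAr.
  by rewrite scalemxAl.
Qed.

End linear_model_algebra.

(** * The selection event *)

Section selection_event.
Context {R : realType} (n P : nat) (X : 'M[R]_(n, P)).
Context (O : 'I_P.+1) (c : 'I_P.+1 -> R) (c_O : c O = 0).

(** The order [O] always passes its test, so the maximum is attained. [lift ord0 j] is the order
    [j + 1]: [p <= j] runs through the orders above [p]. *)
Lemma p_hatP (p : 'I_P.+1) (Y : 'cV[R]_n) : (O <= p)%N ->
  p_hat X O c Y = p :> nat <->
  c p <= `|T_stat X p Y| /\
  forall j : 'I_P, (p <= j)%N -> `|T_stat X (lift ord0 j) Y| < c (lift ord0 j).
Proof.
move=> Op; rewrite /p_hat.
set Q := fun q : 'I_P.+1 => (O <= q)%N && (c q <= `|T_stat X q Y|).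
have QO : Q O by rewrite /Q leqnn c_O normr_ge0.
split=> [maxE|[cp cq]].
  have [q Qq] := @eq_bigmax_cond _ Q (fun q => q : nat) (ltac:(by apply/card_gt0P; exists O)).
  rewrite maxE => /val_inj pq; have /andP[_ cp] : Q p by rewrite pq.
  split=> // j pj; rewrite ltNge; apply/negP => cj.
  have : Q (lift ord0 j) by rewrite /Q cj (leq_trans Op)//= /bump (leq_trans pj).
  move=> /(@leq_bigmax_cond _ Q (fun q => q : nat)); rewrite maxE.
  by rewrite /= /bump leq0n add1n ltnNge pj.
apply/eqP; rewrite eqn_leq; apply/andP; split; last first.
  by apply: (@leq_bigmax_cond _ Q (fun q => q : nat)); rewrite /Q Op cp.
apply/bigmax_leqP => q /andP[_ cqq]; rewrite leqNgt; apply/negP => pq.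
have [j qj] : exists j, q = lift ord0 j.
  by case: (unliftP ord0 q) => [j ->|q0]; [exists j|rewrite q0 in pq].
have pj : (p <= j)%N by move: pq; rewrite qj.
by have := cq j pj; rewrite -qj ltNge cqq.
Qed.

End selection_event.

Section statistics.
Context {R : realType} (n P : nat) (X F : 'M[R]_(n, P)) (U : 'M[R]_P)
  (E : 'M[R]_(n, n - P)).
Context (XE : X = F *m U) (FF : F^T *m F = 1%:M) (uU : U \in unitmx)
  (tU : forall i j : 'I_P, (j < i)%N -> U i j = 0) (dU : forall i, 0 < U i i)
  (EE : E^T *m E = 1%:M) (FE1 : F *m F^T + E *m E^T = 1%:M).
Context (n_gt0 : (0 < n)%N) (theta : 'cV[R]_P) (sigma : R) (sigma_gt0 : 0 < sigma).
Local Notation sn := (Num.sqrt (n%:R : R)).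

(** The map that carries [std_gaussian m] to [scaled_chi m]. *)
Definition rms m (v : 'cV[R]_m) : R := (Num.sqrt m%:R)^-1 * Num.sqrt (\sum_i v i 0 ^+ 2).

(** The statistic as a function of the relative scale [s] and the centred numerator [e], which are
    independent and will be integrated separately. *)
Definition studentized (q : 'I_P.+1) (s e : R) : R :=
  (sn * coordinate (eta_n X theta q) q + e) / (sigma * s * xi X q).

Lemma sigma_hatE u :
  sigma_hat X (X *m theta + sigma *: u) = sigma * rms (E^T *m u).
Proof.
rewrite /sigma_hat (residualE XE FF uU tU).
have -> : sigma *: u - F *m (F^T *m (sigma *: u)) = sigma *: (E *m (E^T *m u)).
  rewrite -!scalemxAr -scalerBr; congr (_ *: _).
  by rewrite -{1}[u]mul1mx -FE1 mulmxDl !mulmxA addrAC subrr add0r.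
set v := E^T *m u.
have -> : (sigma *: (E *m v))^T *m (sigma *: (E *m v)) = sigma ^+ 2 *: (v^T *m v).
  have -> : (sigma *: (E *m v))^T = sigma *: (v^T *m E^T) by rewrite linearZ /= trmx_mul.
  rewrite -scalemxAl -scalemxAr scalerA -expr2 -!mulmxA.
  by rewrite (mulmxA E^T) EE mul1mx.
have vv : (v^T *m v) 0 0 = \sum_i v i 0 ^+ 2.
  by rewrite mxE; apply: eq_bigr => i _; rewrite mxE -expr2.
rewrite mxE vv mulrCA sqrtrM ?sqr_ge0// sqrtr_sqr gtr0_norm//; congr (_ * _).
by rewrite sqrtrM ?invr_ge0// sqrtrV.
Qed.

Lemma T_statE (q : 'I_P.+1) (i : 'I_P) u : q = i.+1 :> nat ->
  T_stat X q (X *m theta + sigma *: u) =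
  studentized q (rms (E^T *m u)) (sigma * xi X q * (F^T *m u) i 0).
Proof.
move=> qi; rewrite /T_stat qi /= -qi sigma_hatE /studentized; congr (_ / _).
rewrite (theta_tildeD XE FF uU tU) -(eta_nE XE FF uU tU) [X in coordinate _ X]qi.
rewrite [X in coordinate (eta_n _ _ _) X]qi !coordinateS.
rewrite mxE mulrDr; congr (_ + _).
have := coordinate_theta_tilde XE FF uU tU dU n_gt0 (sigma *: u) qi.
rewrite [X in coordinate _ X]qi coordinateS => ->.
by rewrite -scalemxAr mxE; ring.
Qed.

(** At order 0 the denominator is 0, and division by 0 returns the value 0 of [T_stat], whatever [e]
    is. *)
Lemma T_stat0 (q : 'I_P.+1) u e : q = 0%N :> nat ->
  T_stat X q (X *m theta + sigma *: u) = studentized q (rms (E^T *m u)) e.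
Proof.
by move=> q0; rewrite /T_stat q0 eqxx /studentized xi0// mulr0 invr0 mulr0.
Qed.

End statistics.

Section submatrix_measurability.
Context {R : realType} d (S : measurableType d).

Lemma measurable_usubmx m1 m2 n (f : S -> 'M[R]_(m1 + m2, n)) :
  measurable_fun setT f -> measurable_fun setT (fun x => usubmx (f x)).
Proof.
move=> /measurable_fun_mxP mf; apply/measurable_fun_mxP => i j.
by under eq_fun do rewrite mxE; exact: mf.
Qed.

Lemma measurable_dsubmx m1 m2 n (f : S -> 'M[R]_(m1 + m2, n)) :
  measurable_fun setT f -> measurable_fun setT (fun x => dsubmx (f x)).
Proof.
move=> /measurable_fun_mxP mf; apply/measurable_fun_mxP => i j.
by under eq_fun do rewrite mxE; exact: mf.
Qed.

End submatrix_measurability.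

(** * Regression of the statistics on the target *)

Section joint_law.
Context {R : realType}.

(** [H] sends the coordinates [(w, v)] to target, residual, [p]-th numerator and later coordinates;
    [K] builds these blocks from fresh coordinates. The hypotheses say that [b] solves the normal
    equations and [t ^+ 2] is the residual variance. The signs of [- t] and [- D] leave the Gram
    matrix alone and lead to the form [|M - a|] of [Delta]. *)
Lemma block_gram k m P (M : 'M[R]_(k, P)) (r : 'rV[R]_P) (D : 'M[R]_P)
    (L : 'M[R]_k) (b : 'rV[R]_k) (t : R) :
  M *m M^T = L *m L^T -> M *m r^T = L *m L^T *m b^T ->
  r *m r^T = b *m (L *m L^T) *m b^T + (t ^+ 2)%:M ->
  M *m D^T = 0 -> r *m D^T = 0 ->
  let H : 'M[R]_(k + (m + (1 + P)), P + m) :=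
    col_mx (row_mx M 0) (block_mx 0 1%:M (col_mx r D) 0) in
  let K : 'M[R]_(k + (m + (1 + P)), k + (m + (1 + P))) :=
    block_mx L 0 (col_mx 0 (col_mx (b *m L) 0))
      (block_mx 1%:M 0 0 (block_mx (- t)%:M 0 0 (- D))) in
  H *m H^T = K *m K^T.
Proof.
move=> ML Mr rr MD rD H K.
have Dr : D *m r^T = 0 by rewrite -[LHS]trmxK trmx_mul trmxK rD trmx0.
have simp0 := (trmx0, mulmx0, mul0mx, addr0, add0r, trmx1, mulmx1).
set HZ := row_mx M 0 in H *; set HY := block_mx 0 1%:M (col_mx r D) 0 in H *.
set K2 := col_mx 0 _ in K *; set K3 := block_mx 1%:M 0 0 _ in K *.
have HZY : HZ *m HY^T = L *m K2^T.
  rewrite /HZ /HY /K2 tr_block_mx !tr_col_mx mul_row_block !mul_mx_row !simp0.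
  by rewrite Mr MD trmx_mul !mulmxA.
have HYY : HY *m HY^T = K2 *m K2^T + K3 *m K3^T.
  rewrite /HY /K2 /K3 !tr_block_mx !tr_col_mx !mulmx_block !mul_col_row !simp0.
  rewrite !add_block_mx !simp0 rr rD Dr.
  rewrite tr_scalar_mx -scalar_mxM mulrNN -expr2 trmx_mul !mulmxA.
  have -> : (- D)^T = - D^T by apply/matrixP => i j; rewrite !mxE.
  by rewrite mulNmx mulmxN opprK.
have HZZ : HZ *m HZ^T = L *m L^T by rewrite /HZ tr_row_mx mul_row_col !simp0.
rewrite /H /K tr_col_mx mul_col_row tr_block_mx mulmx_block !simp0 HZZ HZY HYY.
congr (block_mx _ _ _ _).
by rewrite -[LHS]trmxK trmx_mul trmxK HZY trmx_mul trmxK.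
Qed.

Local Open Scope ereal_scope.

Lemma gaussian_scalar_mulmx n p q (N : 'M[R]_(p, n)) (K : 'M[R]_(p, q)) (s : R)
    (B : set 'cV[R]_p) : measurable B -> (s ^+ 2 *: (N *m N^T) = K *m K^T)%R ->
  gaussian (s ^+ 2)%:M [set u | B (N *m u)] = std_gaussian q [set y | B (K *m y)].
Proof.
move=> mB NK; set L := cholesky ((s ^+ 2)%:M : 'M[R]_n).
have LL : (L *m L^T = (s ^+ 2)%:M)%R.
  have := cholesky_gram (s%:M : 'M[R]_n).
  by rewrite tr_scalar_mx -scalar_mxM -expr2.
transitivity (std_gaussian n [set y | B ((N *m L) *m y)%R]).
  rewrite -[LHS]/(std_gaussian n [set y | B (N *m (L *m y))%R]).
  by congr (std_gaussian n _); apply/seteqP; split=> y /=; rewrite mulmxA.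
apply: eq_std_gaussian_mulmx => //.
by rewrite trmx_mul -mulmxA (mulmxA L) LL mul_scalar_mx -scalemxAr.
Qed.

Lemma gaussian_joint_law n m k P (F : 'M[R]_(n, P)) (E : 'M[R]_(n, m))
    (M : 'M[R]_(k, P)) (r : 'rV[R]_P) (D : 'M[R]_P) (b : 'rV[R]_k) (s t : R)
    (S : 'M[R]_k) (B : set 'cV[R]_(k + (m + (1 + P)))) : s != 0%R ->
  (F^T *m F = 1%:M)%R -> (F^T *m E = 0)%R -> (E^T *m E = 1%:M)%R ->
  (M *m M^T = S)%R -> (M *m r^T = S *m b^T)%R ->
  (r *m r^T = b *m S *m b^T + (t ^+ 2)%:M)%R ->
  (M *m D^T = 0)%R -> (r *m D^T = 0)%R -> measurable B ->
  gaussian (s ^+ 2)%:M [set u |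
    let w := (F^T *m (s^-1 *: u))%R in let v := (E^T *m (s^-1 *: u))%R in
    B (col_mx (M *m w) (col_mx v (col_mx (r *m w) (D *m w))))] =
  \int[gaussian S]_z \int[std_gaussian m]_v std_gaussian (1 + P) [set y |
    B (col_mx z (col_mx v (col_mx (b *m z - t *: usubmx y) (- (D *m dsubmx y)))))%R].
Proof.
move=> s0 FF FE EE MS Mr rr MD rD mB; set L := cholesky S.
have EF : (E^T *m F = 0)%R by rewrite -[LHS]trmxK trmx_mul trmxK FE trmx0.
have LS : (L *m L^T = S)%R by rewrite /L -MS cholesky_gram.
pose H : 'M[R]_(k + (m + (1 + P)), P + m) :=
  col_mx (row_mx M 0) (block_mx 0 1%:M (col_mx r D) 0).
pose K : 'M[R]_(k + (m + (1 + P)), k + (m + (1 + P))) :=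
  block_mx L 0 (col_mx 0 (col_mx (b *m L) 0))
      (block_mx 1%:M 0 0 (block_mx (- t)%:M 0 0 (- D))).
have HK : (H *m H^T = K *m K^T)%R by apply: block_gram; rewrite ?LS.
pose Q := row_mx F E.
have QQ : (Q^T *m Q = 1%:M)%R.
  by rewrite tr_row_mx mul_col_row FF FE EF EE -scalar_mx_block.
pose N := (s^-1 *: (H *m Q^T))%R.
have NE u : (N *m u)%R = (col_mx (M *m (F^T *m (s^-1 *: u)))
   (col_mx (E^T *m (s^-1 *: u))
     (col_mx (r *m (F^T *m (s^-1 *: u))) (D *m (F^T *m (s^-1 *: u))))))%R.
  rewrite /N -scalemxAl scalemxAr -mulmxA /Q tr_row_mx mul_col_mx /H mul_col_mx.
  by rewrite mul_row_col mul_block_col !mul0mx addr0 mul1mx add0r addr0 mul_col_mx.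
have KE z0 v (y : 'cV[R]_(1 + P)) : (K *m col_mx z0 (col_mx v y) = col_mx (L *m z0) (col_mx v
    (col_mx (b *m (L *m z0) - t *: usubmx y) (- (D *m dsubmx y)))))%R.
  have K2E : (col_mx 0 (col_mx (b *m L) 0) *m z0 =
      col_mx 0 (col_mx (b *m L *m z0) 0) :> 'cV[R]_(m + (1 + P)))%R.
    by rewrite !mul_col_mx !mul0mx.
  rewrite /K mul_block_col mul_block_col K2E !mul0mx !addr0 !add0r mul1mx.
  have -> : (block_mx (- t)%:M 0 0 (- D) *m y =
      col_mx (- (t *: usubmx y)) (- (D *m dsubmx y)) :> 'cV[R]_(1 + P))%R.
    rewrite -{1}[y]vsubmxK mul_block_col !mul0mx addr0 add0r.
    by rewrite mul_scalar_mx scaleNr mulNmx.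
  by rewrite !add_col_mx !add0r mulmxA.
have -> : [set u |
    let w := (F^T *m (s^-1 *: u))%R in let v := (E^T *m (s^-1 *: u))%R in
    B (col_mx (M *m w) (col_mx v (col_mx (r *m w) (D *m w))))] = [set u | B (N *m u)].
  by apply/seteqP; split=> u /=; rewrite NE.
rewrite (@gaussian_scalar_mulmx _ _ _ N K)//; last first.
  have -> : (N^T = s^-1 *: (Q *m H^T))%R by rewrite /N linearZ /= trmx_mul trmxK.
  rewrite /N -scalemxAl -scalemxAr !scalerA (_ : s ^+ 2 * s^-1 * s^-1 = 1)%R; last by field.
  by rewrite scale1r -mulmxA (mulmxA Q^T) QQ mul1mx.
have mK : measurable [set y | B (K *m y)] by apply: measurable_preimageT => //; exact: measurable_mulmx.
(* Fixing the first [k] coordinates [z0] fixes the target [L *m z0]. The rest depends on [z0]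
   through it alone, so the outer integral is one against [gaussian S]. *)
rewrite std_gaussianD//.
pose g (z : 'cV[R]_k) := \int[std_gaussian m]_v std_gaussian (1 + P) [set y |
    B (col_mx z (col_mx v (col_mx (b *m z - t *: usubmx y) (- (D *m dsubmx y)))))%R].
pose col3 (x : 'cV[R]_k * ('cV[R]_m * 'cV[R]_(1 + P))) : 'cV[R]_(k + (m + (1 + P))) :=
  (col_mx x.1 (col_mx x.2.1
      (col_mx (b *m x.1 - t *: usubmx x.2.2) (- (D *m dsubmx x.2.2)))))%R.
have mcol3 : measurable_fun setT col3.
  have mx2 : measurable_fun setT (fun x : 'cV[R]_k * ('cV[R]_m * 'cV[R]_(1 + P)) => x.2.2).
    exact: (measurableT_comp measurable_snd measurable_snd).
  apply: measurable_col_mx => //; apply: measurable_col_mx.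
    exact: (measurableT_comp measurable_fst measurable_snd).
  have mN p (f : 'cV[R]_k * ('cV[R]_m * 'cV[R]_(1 + P)) -> 'cV[R]_p) :
      measurable_fun setT f -> measurable_fun setT (fun x => - f x)%R.
    move=> mf; rewrite (_ : (fun x => _) = fun x => (-1 *: f x)%R).
      exact: measurable_scalemx.
    by apply/funext => x; rewrite scaleN1r.
  apply: measurable_col_mx.
    apply: measurable_addmx; first exact: measurable_mulmx.
    by apply: mN; apply: measurable_scalemx => //; exact: (measurable_usubmx mx2).
  by apply: mN; apply: measurable_mulmx; exact: (measurable_dsubmx mx2).
have gE z : g z = std_gaussian (m + (1 + P)) [set y | B (col3 (z, (usubmx y, dsubmx y)))].
  rewrite std_gaussianD; last first.
    apply: measurable_preimageT => //; apply: (measurableT_comp mcol3).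
    apply/measurable_fun_pair => //; apply/measurable_fun_pair => //.
      exact: measurable_usubmx.
    exact: measurable_dsubmx.
  apply: eq_integral => v _; congr (std_gaussian (1 + P) _).
  by apply/seteqP; split=> y /=; rewrite col_mxKu col_mxKd.
have mg : measurable_fun setT g.
  rewrite (_ : g = fun z => std_gaussian (m + (1 + P)) [set y | B (col3 (z, (usubmx y, dsubmx y)))]);
    last exact/funext.
  apply: (@measurable_fun_section _ _ _ _ _ (std_gaussian (m + (1 + P)))
    [set z | B (col3 (z.1, (usubmx z.2, dsubmx z.2)))]).
  apply: measurable_preimageT => //; apply: (measurableT_comp mcol3).
  apply/measurable_fun_pair => //; apply/measurable_fun_pair => //.
    exact: (measurable_usubmx measurable_snd).
  exact: (measurable_dsubmx measurable_snd).
have g0 z : 0 <= g z by apply: integral_ge0.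
rewrite -[RHS]/(\int[gaussian S]_z g z) (ge0_integral_distribution (mxact L) mg g0).
apply: eq_integral => z0 _; rewrite /= gE; congr (std_gaussian (m + (1 + P)) _).
suff E3 y : (K *m col_mx z0 y = col3 (mxact L z0, (usubmx y, dsubmx y)))%R.
  by apply/seteqP; split=> y /=; rewrite E3.
by rewrite -{1}[y]vsubmxK KE.
Qed.

End joint_law.

(** * Selection probability given the scale and the target *)

Section selection_probability.
Context {R : realType} (n P : nat) (X : 'M[R]_(n, P)) (theta : 'cV[R]_P) (sigma : R).
Context (c : 'I_P.+1 -> R) (p : 'I_P.+1).
Notation N01 := (normal_prob (0 : R) 1).
Local Notation stud := (studentized X theta sigma).

Definition selected (s e : R) (w : 'cV[R]_P) : Prop :=
  c p <= `|stud p s e| /\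
  forall j : 'I_P, (p <= j)%N ->
    `|stud (lift ord0 j) s (sigma * xi X (lift ord0 j) * w j 0)| < c (lift ord0 j).

Lemma measurable_inv : measurable_fun setT (@GRing.inv R).
Proof.
(* The real power is the inverse on nonnegative bases, hence the square; at 0 both sides are 0. *)
rewrite (_ : @GRing.inv R = fun x => x * (x ^+ 2) `^ (-1)).
  apply: measurable_funM => //.
  by apply: (measurableT_comp (@measurable_powR R (-1))); exact: measurable_funX.
apply/funext => x; rewrite powR_inv1 ?sqr_ge0//.
by have [->|x0] := eqVneq x 0; [rewrite invr0 mul0r|field].
Qed.

Lemma measurable_studentized d (S : measurableType d) q (s f : S -> R) :
  measurable_fun setT s -> measurable_fun setT f ->
  measurable_fun setT (fun x => `|stud q (s x) (f x)|).
Proof.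
move=> ms mf; apply: (measurableT_comp (@normr_measurable R setT)).
apply: measurable_funM; first exact: measurable_funD.
apply: (measurableT_comp measurable_inv).
by apply: measurable_funM => //; exact: measurable_funM.
Qed.

Lemma measurable_studentized_ge d (S : measurableType d) q (s f : S -> R) (a : R) :
  measurable_fun setT s -> measurable_fun setT f ->
  measurable [set x | a <= `|stud q (s x) (f x)|].
Proof.
move=> ms mf.
rewrite (_ : [set x | _] = [set x | `[a, +oo[%classic `|stud q (s x) (f x)|]).
  by apply: measurable_preimageT => //; exact: measurable_studentized.
by apply/seteqP; split=> x /=; rewrite in_itv /= andbT.
Qed.

Lemma measurable_studentized_lt d (S : measurableType d) q (s f : S -> R) (a : R) (b : bool) :
  measurable_fun setT s -> measurable_fun setT f ->
  measurable [set x | b -> `|stud q (s x) (f x)| < a].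
Proof.
move=> ms mf; case: b; last by rewrite (_ : [set x | _] = setT)//; apply/seteqP; split.
rewrite (_ : [set x | _] = [set x | `]-oo, a[%classic `|stud q (s x) (f x)|]).
  by apply: measurable_preimageT => //; exact: measurable_studentized.
by apply/seteqP; split=> x /=; rewrite in_itv /=; [apply|move=> + _].
Qed.

Lemma measurable_selected d (S : measurableType d) (s e : S -> R) (w : S -> 'cV[R]_P) :
  measurable_fun setT s -> measurable_fun setT e -> measurable_fun setT w ->
  measurable [set x | selected (s x) (e x) (w x)].
Proof.
move=> ms me /measurable_fun_mxP mw.
have -> : [set x | selected (s x) (e x) (w x)] =
    [set x | c p <= `|stud p (s x) (e x)|] `&`
    \bigcap_(j in [set: 'I_P]) [set x | (p <= j)%N ->
      `|stud (lift ord0 j) (s x) (sigma * xi X (lift ord0 j) * w x j 0)| < c (lift ord0 j)].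
  by apply/seteqP; split=> x [H1 H2]; split=> // j; [move=> _; exact: H2|exact: (H2 j)].
apply: measurableI; first exact: measurable_studentized_ge.
apply: fin_bigcap_measurable => // j _.
apply: (@measurable_studentized_lt _ _ (lift ord0 j) s
  (fun x => sigma * xi X (lift ord0 j) * w x j 0)) => //.
exact: measurable_funM.
Qed.

(** Zeroing the first [p] coordinates rather than dropping them keeps the dimension [P] for every
    order. *)
Definition upper_proj : 'M[R]_P := diag_mx (\row_j (p <= j)%:R).

Lemma upper_projE (w : 'cV[R]_P) (j : 'I_P) : (p <= j)%N -> (upper_proj *m w) j 0 = w j 0.
Proof. by move=> pj; rewrite mul_diag_mx !mxE pj mul1r. Qed.

(** Clearing the positive denominator; the sign is reversed so that [- e] plays the Gaussian
    variable in [Delta]. *)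
Lemma studentized_lt_abs (q : 'I_P.+1) (s e : R) : 0 < sigma -> 0 < s -> 0 < xi X q ->
  (`|stud q s e| < c q) =
  (`|- e - Num.sqrt n%:R * coordinate (eta_n X theta q) q| < s * c q * sigma * xi X q).
Proof.
move=> sig0 s0 xi0; rewrite /studentized normrM normfV.
have y0 : 0 < sigma * s * xi X q by rewrite !mulr_gt0.
rewrite (gtr0_norm y0) ltr_pdivrMr//.
rewrite -[in RHS]normrN opprB opprK; congr (_ < _); ring.
Qed.

Lemma std_gaussian_selected (O : 'I_P.+1) (s d t : R) : 0 < sigma -> 0 < s ->
  (O <= p)%N -> c O = 0 -> (forall q : 'I_P.+1, (0 < q)%N -> 0 < xi X q) ->
  std_gaussian (1 + P) [set y | selected s (d - t * usubmx y 0 0)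
     (- (upper_proj *m dsubmx y))] =
  ((1 - Delta t (Num.sqrt n%:R * coordinate (eta_n X theta p) p + d)
         (s * c p * sigma * xi X p)) *
   \prod_(q < P.+1 | (p < q)%N) gamma X theta sigma c q s)%:E.
Proof.
move=> sig0 s0 Op cO xi_gt0.
pose S0 := [set x : measurableTypeR R | c p <= `|stud p s (d - t * x)|].
pose S1 (j : 'I_P) := [set x : measurableTypeR R | (p <= j)%N ->
  `|stud (lift ord0 j) s (sigma * xi X (lift ord0 j) * - x)| < c (lift ord0 j)].
(* Slot 0 carries the error of the [p]-th test, slot [j + 1] the test of order [j + 1], void for
   [j < p]. *)
pose S (i : 'I_P.+1) := if unlift ord0 i is Some j then S1 j else S0.
have -> : [set y | selected s (d - t * usubmx y 0 0) (- (upper_proj *m dsubmx y))] =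
    [set y : 'cV[R]_(1 + P) | forall i : 'I_P.+1, S i (y i 0)].
  have w_j (y : 'cV[R]_(1 + P)) (j : 'I_P) : (p <= j)%N ->
      (- (upper_proj *m dsubmx y)) j 0 = - y (lift ord0 j) 0.
    move=> pj; rewrite mxE upper_projE// mxE; congr (- y _ _); exact/val_inj.
  have y_0 (y : 'cV[R]_(1 + P)) : usubmx y 0 0 = y ord0 0.
    by rewrite mxE; congr (y _ _); exact/val_inj.
  apply/seteqP; split=> y /=.
    move=> [H0 H1] i; rewrite /S; case: unliftP => [j ->|->].
      by move=> pj; rewrite -w_j//; exact: H1.
    by rewrite /S0 /= -y_0.
  move=> HS; split=> [|j pj].
    by have := HS ord0; rewrite /S unlift_none /S0 /= y_0.
  by have := HS (lift ord0 j); rewrite /S liftK /S1 /= w_j//; exact.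
have mS i : measurable (S i).
  rewrite /S; case: unliftP => [j _|_]; last first.
    apply: (@measurable_studentized_ge _ _ p (fun=> s) (fun x : measurableTypeR R => d - t * x)) => //.
    by apply: measurable_funB => //; exact: measurable_funM.
  apply: (@measurable_studentized_lt _ _ (lift ord0 j) (fun=> s)
    (fun x : measurableTypeR R => sigma * xi X (lift ord0 j) * - x)) => //.
  by apply: measurable_funM => //; exact: oppr_measurable.
rewrite (std_gaussian_box mS) big_ord_recl; congr (_ * _)%:E.
  rewrite /S unlift_none Delta_std_normal.
  set A := [set x | _].
  have mA : measurable A.
    have mf : measurable_fun setT (fun x : measurableTypeR R =>
        `|t * x - (Num.sqrt n%:R * coordinate (eta_n X theta p) p + d)|).
      apply: (measurableT_comp (@normr_measurable R setT)).
      by apply: measurable_funB => //; exact: measurable_funM.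
    rewrite (_ : A = [set x | `]-oo, s * c p * sigma * xi X p[%classic
        `|t * x - (Num.sqrt n%:R * coordinate (eta_n X theta p) p + d)|]).
      exact: measurable_preimageT.
    by apply/seteqP; split=> x /=; rewrite in_itv.
  have -> : S0 = ~` A.
    have S0A x : (c p <= `|stud p s (d - t * x)|) = ~~
        (`|t * x - (Num.sqrt n%:R * coordinate (eta_n X theta p) p + d)| <
           s * c p * sigma * xi X p).
      (* At [O] the denominator may be 0, so it cannot be cleared; but [c O = 0] makes both sides
         true. *)
      have [pO|pO] := eqVneq p O.
        by rewrite pO cO mulr0 !mul0r normr_ge0 -leNgt normr_ge0.
      have p0 : (0 < p)%N.
        rewrite lt0n; apply: contra pO => /eqP p0; apply/eqP/val_inj.
        by move: Op; rewrite /= p0 leqn0 => /eqP ->.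
      rewrite leNgt studentized_lt_abs// ?xi_gt0//; congr (~~ (`|_| < _)); ring.
    apply/seteqP; split=> x; rewrite /S0 /A /=; first by rewrite S0A => /negP.
    by move=> /negP; rewrite S0A.
  rewrite probability_setC// fineB//; last exact: fin_num_measure.
rewrite [RHS]big_mkcond big_ord_recl /= mul1r; apply: eq_bigr => j _.
rewrite /S liftK /S1 /= /bump leq0n add1n ltnS.
case: (leqP p j) => pj; last first.
  by rewrite (_ : [set x | _] = setT) ?probability_setT//; apply/seteqP; split.
rewrite /gamma Delta_std_normal; congr (fine (N01 _)); apply/seteqP.
have E x : (`|stud (lift ord0 j) s (sigma * xi X (lift ord0 j) * - x)| < c (lift ord0 j)) =
   (`|sigma * xi X (lift ord0 j) * x -
      Num.sqrt n%:R * coordinate (eta_n X theta (lift ord0 j)) (lift ord0 j)| <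
      s * c (lift ord0 j) * sigma * xi X (lift ord0 j)).
  by rewrite studentized_lt_abs// ?xi_gt0// mulrN opprK.
by split=> x /=; rewrite E; [apply|move=> + _].
Qed.

End selection_probability.

(** * Integration against the law of the residual scale *)

Section scaled_chi_density.
Context {R : realType}.
Local Open Scope ereal_scope.
Notation mu := (@lebesgue_measure R).

Lemma measurable_rms m : measurable_fun setT (@rms R m : _ -> measurableTypeR R).
Proof.
apply: measurable_funM => //.
have -> : (fun v : 'cV[R]_m => Num.sqrt (\sum_i v i 0 ^+ 2)) =
   (fun v => (\sum_i v i 0 ^+ 2) `^ 2^-1)%R :> (_ -> R).
  apply/funext => v; rewrite powR12_sqrt//.
  by apply: sumr_ge0 => i _; exact: sqr_ge0.
apply: (measurableT_comp (@measurable_powR R 2^-1)).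
apply: measurable_sum => i; apply: measurable_funX; exact: measurable_mx_entry.
Qed.

(** The density lives on the whole line. The law of [rms] has no mass on the negative axis, as [rms]
    is nonnegative, and none at 0, as it has a density; so the positive half-line carries the
    integral. *)
Lemma ge0_integral_scaled_chi m (h : R -> R) (f : measurableTypeR R -> \bar R) :
  is_density (scaled_chi m) h -> measurable_fun setT f -> (forall s, 0 <= f s) ->
  \int[std_gaussian m]_v f (rms v) =
  \int[mu]_(s in `]0%R, +oo[) (f s * (h s)%:E).
Proof.
move=> [mh h0 hE] mf f0.
pose nu := measure_function_pushforward__canonical__measure_function_Measure
  (std_gaussian m) (@measurable_rms m).
have nuE A : measurable A -> nu A = \int[mu]_(s in A) (h s)%:E by move=> mA; rewrite -hE.
pose D : set (measurableTypeR R) := `]0%R, +oo[%classic.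
pose N : set (measurableTypeR R) := `]-oo, 0%R]%classic.
have mD : measurable D by exact: measurable_itv.
have mN : measurable N by exact: measurable_itv.
have nuN : nu N = 0.
  have -> : nu N = nu [set 0%R].
    congr (std_gaussian m _); apply/seteqP; split=> v; rewrite /N /= in_itv /=; last by move=> ->.
    move=> v0; apply/eqP; rewrite eq_le v0 /rms mulr_ge0 ?invr_ge0 ?sqrtr_ge0//.
  rewrite nuE//; apply: null_set_integral => //.
    by apply/measurable_EFinP/measurable_funTS.
  exact: lebesgue_measure_set1.
transitivity (\int[nu]_s f s).
  by rewrite (ge0_integral_pushforward (@measurable_rms m)).
rewrite (@ge0_negligible_integral _ _ _ nu setT N)//.
have -> : setT `\` N = D.
  by apply/seteqP; split=> s; rewrite /N /D /= !in_itv /= andbT ltNge; [move=> [_ /negP]|move=> /negP].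
rewrite integral_mkcond (@ge0_integral_density _ (measurableTypeR R) R mu nu h _ mh h0 nuE);
  last 2 first.
- have mfD : measurable_fun D f by exact: measurable_funTS.
  exact: ((measurable_restrictT f mD).1 mfD).
- by move=> s; apply: erestrict_ge0.
rewrite [RHS]integral_mkcond; apply: eq_integral => s _.
by rewrite !patchE; case: ifP => _ //; rewrite mul0e.
Qed.

End scaled_chi_density.

(** * Joint law of the selected order and the target *)

(* Real-field instances of scalemxAl and scalemxAr: rewriting with the generic
   lemmas changes the inferred ring structure of the product. *)
Lemma mulZmx {R : realType} m n p (a : R) (A : 'M[R]_(m, n)) (B : 'M[R]_(n, p)) :
  (a *: A) *m B = a *: (A *m B).
Proof. by rewrite scalemxAl. Qed.

Lemma mulmxZ {R : realType} m n p (a : R) (A : 'M[R]_(m, n)) (B : 'M[R]_(n, p)) :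
  A *m (a *: B) = a *: (A *m B).
Proof. by rewrite scalemxAr. Qed.

Section selection_law.
Context {R : realType} (n P k : nat) (P_lt_n : (P < n)%N)
  (X : 'M[R]_(n, P)) (rankX : \rank X = P) (A : 'M[R]_(k, P))
  (theta : 'cV[R]_P) (sigma : R) (sigma_gt0 : 0 < sigma)
  (O : 'I_P.+1) (c : 'I_P.+1 -> R) (c_O : c O = 0)
  (G : 'I_P.+1 -> 'M[R]_k) (h : R -> R)
  (h_density : is_density (scaled_chi (n - P)) h)
  (d : measure_display) (Omega : measurableType d) (Pr : probability Omega R)
  (u : {RV Pr >-> 'cV[R]_n})
  (u_law : forall B : set 'cV[R]_n, measurable B ->
     distribution Pr u B = gaussian ((sigma ^+ 2)%:M) B).
Local Notation sn := (Num.sqrt (n%:R : R)).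
Local Notation Y w := (X *m theta + u w).

(* The event is a function of (Z, V, e, W) with Z the centred estimator of the
   target, V the residual, e the centred numerator of the p-th statistic and W
   those of the following ones; its covariance is that of (z, v, b z - t x, -y)
   with independent Gaussian z, v, x, y. *)
Lemma selection_joint_law (p : 'I_P.+1) (B : set 'cV[R]_k) :
  (O <= p)%N -> generalized_inverse (lin_cov X A p) (G p) -> measurable B ->
  let centre := sn *: (A *m (eta_n X theta p - theta)) in
  let event := [set w | p_hat X O c (Y w) = p :> nat /\
    B (sn *: (A *m (theta_tilde X p (Y w) - theta)))] in
  measurable event /\
  Pr event = (\int[Phi X sigma A p]_(z in [set z | B (z + centre)%R])
    \int[lebesgue_measure]_(s in `]0%R, +oo[)
      ((1 - gamma_star X theta sigma c A G p z s) *
       (\prod_(q < P.+1 | (p < q)%N) gamma X theta sigma c q s) * h s)%R%:E)%E.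
Proof.
move=> Op GS mB centre event.
have n_gt0 : (0 < n)%N by exact: leq_trans P_lt_n.
have [F [U [E [XE uU [tU dU] [FF FE EE] FE1]]]] := qr_decomposition rankX.
have [M0 [SE CE TE]] := linear_target XE FF uU tU dU n_gt0 A p.
set x := xi X p *: last_basis p in CE.
have xi_pos (q : 'I_P.+1) : (0 < q)%N -> 0 < xi X q.
  move=> q0; have iP : (q.-1 < P)%N by rewrite prednK// -ltnS ltn_ord.
  apply: (@xi_gt0 _ _ _ X F U XE FF uU tU dU n_gt0 q (Ordinal iP)).
  by rewrite /= prednK.
have xx : (x^T *m x) 0 0 = xi X p ^+ 2.
  have [p0|p_gt0] := posnP p.
    rewrite xi0// expr0n mxE big1// => l.
    by have := ltn_ord l; rewrite [X in (_ < X)%N]p0.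
  have lp : (p.-1 < p)%N by rewrite prednK.
  rewrite mxE (bigD1 (Ordinal lp))//= big1 => [|l lNp]; rewrite !mxE /=.
    by rewrite prednK// eqxx mulr1 addr0 expr2.
  have /negbTE -> : l.+1 != p :> nat; last by rewrite !mulr0.
  by apply: contra lNp => /eqP lE; apply/eqP/val_inj; rewrite /= -[X in _ = X.-1]lE.
rewrite SE in GS; have [Sb bSb bCx] := generalized_inverse_regression x GS.
rewrite -CE -SE in Sb bSb bCx.
set b := (C_vec X A p)^T *m G p in Sb bSb bCx.
have bE : b_vec X A G p = b by [].
(* [bCx] makes the radicand nonnegative, so the square root does not truncate. *)
have zeta2 : zeta X A G p ^+ 2 = xi X p ^+ 2 - (b *m C_vec X A p) 0 0.
  by rewrite sqr_sqrtr// subr_ge0 -xx.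
pose t := sigma * zeta X A G p.
(* Coefficients, in the coordinates [F^T *m u / sigma], of the centred target and the centred [p]-th
   numerator; [D] extracts the later coordinates. *)
pose M : 'M[R]_(k, P) := sigma *: (M0 *m (sel p)^T).
pose r : 'rV[R]_P := sigma *: (x^T *m (sel p)^T).
pose D : 'M[R]_P := upper_proj p.
pose S : 'M[R]_k := sigma ^+ 2 *: lin_cov X A p.
(* Target and [p]-th numerator use the first [p] coordinates, [D] the others: the independence of
   the later statistics. *)
have seD : (sel p)^T *m D^T = 0 :> 'M[R]_(p, P).
  apply/matrixP => i j; rewrite tr_sel_mul /D tr_diag_mx !mxE -val_eqE /=.
  case: eqP => [ij|]; last by rewrite mulr0n.
  by rewrite leqNgt ltn_ord mulr1n.
have ss (q : nat) (N : 'M[R]_(p, q)) : (sel p)^T *m (sel p *m N) = N.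
  by rewrite mulmxA tr_sel_sel mul1mx.
have MT : M^T = sigma *: (sel p *m M0^T) by rewrite /M linearZ /= trmx_mul trmxK.
have rT : r^T = sigma *: (sel p *m x) by rewrite /r linearZ /= trmx_mul !trmxK.
have MM : M *m M^T = S.
  by rewrite MT /M mulZmx mulmxZ scalerA -expr2 -mulmxA ss /S SE.
have Mr : M *m r^T = S *m b^T.
  rewrite rT /M mulZmx mulmxZ scalerA -expr2 -mulmxA ss /S mulZmx Sb.
  by rewrite CE.
have rr : r *m r^T = b *m S *m b^T + (t ^+ 2)%:M.
  rewrite rT /r mulZmx mulmxZ scalerA -expr2 -mulmxA ss /S mulmxZ mulZmx bSb.
  rewrite /t exprMn zeta2 [x^T *m x]mx11_scalar xx.
  have {1}-> := mx11_scalar (b *m C_vec X A p); move: ((b *m C_vec X A p) 0 0) => q.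
  by rewrite !scale_scalar_mx -raddfD /=; congr _%:M; ring.
have MD : M *m D^T = 0 by rewrite /M mulZmx -mulmxA seD mulmx0 scaler0.
have rD : r *m D^T = 0 by rewrite /r mulZmx -mulmxA seD mulmx0 scaler0.
pose BB := [set y : 'cV[R]_(k + ((n - P) + (1 + P))) | B (usubmx y + centre) /\
  selected X theta sigma c p (rms (usubmx (dsubmx y)))
    (usubmx (dsubmx (dsubmx y)) 0 0) (dsubmx (dsubmx (dsubmx y)))].
have mBB : measurable BB.
  have md : measurable_fun setT (fun y : 'cV[R]_(k + ((n - P) + (1 + P))) => dsubmx y).
    exact: measurable_dsubmx.
  have mdd := measurable_dsubmx md.
  apply: (@measurableI _ _ [set y | B (usubmx y + centre)]).
    by apply: measurable_preimageT => //; apply: measurable_addmx => //; exact: measurable_usubmx.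
  apply: measurable_selected.
  - exact: (measurableT_comp (@measurable_rms R (n - P)) (measurable_usubmx md)).
  - exact: (measurableT_comp (measurable_mx_entry 0 0) (measurable_usubmx mdd)).
  - exact: measurable_dsubmx mdd.
have T_p g : T_stat X p (X *m theta + sigma *: g) =
    studentized X theta sigma p (rms (E^T *m g)) ((r *m (F^T *m g)) 0 0).
  have [p0|p_gt0] := posnP p.
    exact: T_stat0.
  have iP : (p.-1 < P)%N by rewrite prednK// -ltnS ltn_ord.
  have lp : (p.-1 < p)%N by rewrite prednK.
  rewrite (T_statE XE FF uU tU dU EE FE1 n_gt0 theta sigma_gt0 (i := Ordinal iP));
    last by rewrite /= prednK.
  congr studentized; rewrite /r mulZmx -mulmxA [RHS]mxE -mulrA; congr (_ * _).
  set y := F^T *m g; rewrite [RHS]mxE (bigD1 (Ordinal lp))//= big1 => [|l lNp]; last first.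
    have /negbTE E0 : l.+1 != p :> nat.
      by apply: contra lNp => /eqP lE; apply/eqP/val_inj; rewrite /= -[X in _ = X.-1]lE.
    by rewrite !mxE E0 mulr0 mul0r.
  rewrite tr_sel_mul addr0 [x^T _ _]mxE [x _ _]mxE [last_basis p _ _]mxE /= prednK//.
  by rewrite eqxx mulr1; congr (_ * y _ _); exact/val_inj.
have selE g : selected X theta sigma c p (rms (E^T *m g)) ((r *m (F^T *m g)) 0 0)
    (D *m (F^T *m g)) <-> p_hat X O c (X *m theta + sigma *: g) = p :> nat.
  rewrite p_hatP// /selected -T_p.
  have T_j (j : 'I_P) : (p <= j)%N -> T_stat X (lift ord0 j) (X *m theta + sigma *: g) =
      studentized X theta sigma (lift ord0 j) (rms (E^T *m g))
        (sigma * xi X (lift ord0 j) * (D *m (F^T *m g)) j 0).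
    move=> pj; rewrite upper_projE//.
    exact: (T_statE XE FF uU tU dU EE FE1 n_gt0 theta sigma_gt0).
  by split=> -[H0 H1]; split=> // j pj; [rewrite T_j//|rewrite -T_j//]; exact: H1.
pose EV := [set v : 'cV[R]_n |
    let w := F^T *m (sigma^-1 *: v) in let e := E^T *m (sigma^-1 *: v) in
    BB (col_mx (M *m w) (col_mx e (col_mx (r *m w) (D *m w))))].
have eventE : event = u @^-1` EV.
  have s0 : sigma != 0 by rewrite gt_eqF.
  have tE g : sn *: (A *m (theta_tilde X p (X *m theta + sigma *: g) - theta)) =
      M *m (F^T *m g) + centre.
    rewrite (theta_tildeD XE FF uU tU) -(eta_nE XE FF uU tU) addrAC mulmxDr scalerDr.
    rewrite TE [RHS]addrC; congr (_ + _).
    by rewrite /M !mulmxZ mulZmx !mulmxA.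
  apply/seteqP; split=> w; rewrite /event /EV /BB /= !col_mxKu !col_mxKd !col_mxKu;
    set g := sigma^-1 *: u w; have -> : u w = sigma *: g by rewrite /g scalerA divff// scale1r.
    by rewrite tE -selE => -[].
  by rewrite tE -selE => -[].
have mEV : measurable EV.
  have mg : measurable_fun setT (fun v : 'cV[R]_n => sigma^-1 *: v) by exact: measurable_scalemx.
  have mw : measurable_fun setT (fun v : 'cV[R]_n => F^T *m (sigma^-1 *: v)).
    exact: measurable_mulmx.
  apply: measurable_preimageT => //.
  by do 3 (apply: measurable_col_mx; first exact: measurable_mulmx); exact: measurable_mulmx.
have mevent : measurable event by rewrite eventE; apply: measurable_preimageT.
split=> //.
have -> : Pr event = gaussian ((sigma ^+ 2)%:M) EV by rewrite eventE -u_law.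
rewrite (gaussian_joint_law _ FF FE EE MM Mr rr MD rD mBB) ?gt_eqF//.
rewrite [RHS]integral_mkcond; apply: eq_integral => z _; rewrite patchE.
case: ifPn => [/set_mem Bz|/negP Bz]; last first.
  apply: integral0_eq => v _; rewrite (_ : [set y | _] = set0) ?measure0//.
  by apply/seteqP; split=> y //=; rewrite /BB /= col_mxKu => -[Bz' _]; case: Bz; rewrite inE.
(* Given [z], the residual enters through [rms v] only, so the integral over [v] becomes one over
   the scale. *)
pose Fz (s : measurableTypeR R) := std_gaussian (1 + P) [set y |
  selected X theta sigma c p s ((b *m z) 0 0 - t * usubmx y 0 0) (- (D *m dsubmx y))].
have mFz : measurable_fun setT Fz.
  apply: (@measurable_fun_section _ _ _ _ _ (std_gaussian (1 + P))
    [set sy | selected X theta sigma c p sy.1 ((b *m z) 0 0 - t * usubmx sy.2 0 0)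
      (- (D *m dsubmx sy.2))]).
  apply: measurable_selected => //.
    apply: measurable_funB => //; apply: measurable_funM => //.
    apply: (measurableT_comp (measurable_mx_entry 0 0)).
    exact: (measurable_usubmx measurable_snd).
  rewrite (_ : (fun x => _) =
    fun x : measurableTypeR R * 'cV[R]_(1 + P) => (- D) *m dsubmx x.2); last first.
    by apply/funext => y; rewrite mulNmx.
  by apply: measurable_mulmx; exact: (measurable_dsubmx measurable_snd).
transitivity (\int[std_gaussian (n - P)]_v Fz (rms v))%E.
  apply: eq_integral => v _; congr (std_gaussian (1 + P) _).
  have e00 (y : 'cV[R]_(1 + P)) :
      (b *m z - t *: usubmx y) 0 0 = (b *m z) 0 0 - t * usubmx y 0 0.
    by rewrite mxE [X in _ + X]mxE [X in - X]mxE.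
  apply/seteqP; split=> y; rewrite /BB /= !col_mxKu !col_mxKd !col_mxKu e00; first by case.
  by split.
rewrite (ge0_integral_scaled_chi h_density mFz (fun=> measure_ge0 _ _)).
apply: eq_integral => s; rewrite inE /= in_itv /= andbT => s_gt0.
rewrite /Fz (std_gaussian_selected theta _ t sigma_gt0 s_gt0 Op c_O xi_pos).
by rewrite -EFinM.
Qed.

End selection_law.

(** * Summation over the selected order *)

Section finite_decomposition.
Context {R : realType}.
Local Open Scope ereal_scope.

Lemma measure_ord_partition d (T : measurableType d) (mu : {measure set T -> \bar R})
    n (D : pred 'I_n) (F : 'I_n -> set T) (E : set T) :
  (forall i, D i -> measurable (F i)) -> (forall i, D i -> F i `<=` E) ->
  (forall x, E x -> exists2 i, D i & F i x) ->
  (forall i j x, F i x -> F j x -> i = j) ->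
  mu E = \sum_(i < n | D i) mu (F i).
Proof.
move=> mF FE EF F_uniq.
rewrite (_ : E = \big[setU/set0]_(i < n | D i) F i); last first.
  apply/seteqP; split=> [x /EF[i Di Fx]|].
    by rewrite (bigD1 i)//=; left.
  by elim/big_ind: _ => // [A B AE BE x [/AE|/BE]].
apply: measure_bigsetU_ord_cond => // i j _ _ [x [Fi Fj]]; exact: F_uniq Fi Fj.
Qed.

Lemma Delta_0 (s a : R) : Delta s a 0 = 0%R.
Proof.
rewrite Delta_std_normal (_ : [set x | _] = set0) ?measure0//.
by apply/seteqP; split=> x //=; rewrite normr_lt0.
Qed.

Lemma measurable_lower_orthant k (t : 'cV[R]_k) : measurable (lower_orthant t).
Proof.
rewrite (_ : lower_orthant t = \bigcap_(i in [set: 'I_k])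
   [set z : 'cV[R]_k | `]-oo, t i 0%R]%classic (z i 0%R)]).
  apply: fin_bigcap_measurable => // i _; apply: measurable_preimageT => //.
  exact: measurable_mx_entry.
apply/seteqP; split=> z H i; first by move=> _; rewrite /= in_itv /=; exact: H.
by have := H i I; rewrite /= in_itv.
Qed.

End finite_decomposition.

Theorem mainTheorem1 (R : realType) (n P k : nat)
  (P_ge1 : (1 <= P)%N) (P_lt_n : (P < n)%N) (k_bounds : (1 <= k <= P)%N)
  (X : 'M[R]_(n, P)) (rankX : \rank X = P)
  (A : 'M[R]_(k, P)) (rankA : \rank A = k)
  (theta : 'cV[R]_P) (sigma : R) (sigma_gt0 : 0 < sigma)
  (O : 'I_P.+1) (O_lt_P : (O < P)%N)
  (c : 'I_P.+1 -> R) (c_O : c O = 0)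
  (c_gt0 : forall p : 'I_P.+1, (O < p)%N -> 0 < c p)
  (G : 'I_P.+1 -> 'M[R]_k)
  (G_inverse : forall p : 'I_P.+1, (0 < p)%N ->
     generalized_inverse (lin_cov X A p) (G p))
  (h : R -> R) (h_density : is_density (scaled_chi (n - P)) h)
  (d : measure_display) (Omega : measurableType d) (Pr : probability Omega R)
  (u : {RV Pr >-> 'cV[R]_n})
  (u_law : forall B : set 'cV[R]_n, measurable B ->
     distribution Pr u B = gaussian ((sigma ^+ 2)%:M) B) :
  let Y (w : Omega) : 'cV[R]_n := X *m theta + u w in
  let gam (q : 'I_P.+1) (s : R) : R := gamma X theta sigma c q s in
  let gam_star (q : 'I_P.+1) (z : 'cV[R]_k) (s : R) : R :=
    gamma_star X theta sigma c A G q z s in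
  let centre (p : 'I_P.+1) : 'cV[R]_k :=
    Num.sqrt n%:R *: (A *m (eta_n X theta p - theta)) in
  [/\ Pr [set w | p_hat X O c (Y w) = O :> nat] =
        (\int[lebesgue_measure]_(s in `]0%R, +oo[)
          ((\prod_(q < P.+1 | (O < q)%N) gam q s) * h s)%R%:E)%E,
      forall p : 'I_P.+1, (O < p)%N ->
        Pr [set w | p_hat X O c (Y w) = p :> nat] =
          (\int[lebesgue_measure]_(s in `]0%R, +oo[)
            ((1 - gam p s) * (\prod_(q < P.+1 | (p < q)%N) gam q s) *
              h s)%R%:E)%E
    & forall t : 'cV[R]_k,
        Pr [set w | lower_orthant t
              (Num.sqrt n%:R *: (A *m (theta_pms X O c (Y w) - theta)))] =
          (Phi X sigma A O (lower_orthant (t - centre O)) *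
             (\int[lebesgue_measure]_(s in `]0%R, +oo[)
               ((\prod_(q < P.+1 | (O < q)%N) gam q s) * h s)%R%:E) +
           \sum_(p < P.+1 | (O < p)%N)
             \int[Phi X sigma A p]_(z in lower_orthant (t - centre p))
               \int[lebesgue_measure]_(s in `]0%R, +oo[)
                 ((1 - gam_star p z s) *
                   (\prod_(q < P.+1 | (p < q)%N) gam q s) * h s)%R%:E)%E].
Proof.
move=> Y gam gam_star centre.
have Ginv (p : 'I_P.+1) : generalized_inverse (lin_cov X A p) (G p).
  (* At order 0 the covariance is an empty sum, and every matrix is a generalized inverse of 0. *)
  have [p0|] := posnP p; last exact: G_inverse.
  rewrite /generalized_inverse (_ : lin_cov X A p = 0) ?mul0mx//.
  apply/matrixP => i j; rewrite mxE big1 ?mxE// => l.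
  by have := ltn_ord l; rewrite [X in (_ < X)%N]p0.
have Law (p : 'I_P.+1) (B : set 'cV[R]_k) (Op : (O <= p)%N) := @selection_joint_law R n P k P_lt_n X rankX A theta
  sigma sigma_gt0 O c c_O G h h_density d Omega Pr u u_law p B Op (Ginv p).
have Marg (p : 'I_P.+1) : (O <= p)%N -> Pr [set w | p_hat X O c (Y w) = p :> nat] =
    (\int[lebesgue_measure]_(s in `]0%R, +oo[)
      ((1 - gam p s) * (\prod_(q < P.+1 | (p < q)%N) gam q s) * h s)%R%:E)%E.
  (* A zero target matrix and the full set forget the target: [b = 0] and [zeta = xi], so
     [gamma_star] reduces to [gamma]. *)
  move=> Op; pose G0 : 'I_P.+1 -> 'M[R]_k := fun=> 0.
  have G0inv : generalized_inverse (lin_cov X (0 : 'M[R]_(k, P)) p) (G0 p).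
    have -> : lin_cov X (0 : 'M[R]_(k, P)) p = 0.
      by rewrite /lin_cov fcolsE mul0mx !mul0mx.
    by rewrite /generalized_inverse !mul0mx.
  have [_] := @selection_joint_law R n P k P_lt_n X rankX 0 theta
    sigma sigma_gt0 O c c_O G0 h h_density d Omega Pr u u_law p setT Op G0inv measurableT.
  rewrite (_ : [set w | _ /\ _] = [set w | p_hat X O c (Y w) = p :> nat]); last first.
    by apply/seteqP; split=> w; [case|split].
  move=> ->; rewrite (_ : [set z | _] = setT); last by apply/seteqP; split.
  have b0 : b_vec X (0 : 'M[R]_(k, P)) G0 p = 0 by rewrite /b_vec mulmx0.
  under eq_integral => z _.
    under eq_integral => s _.
      have -> : gamma_star X theta sigma c 0 G0 p z s = gam p s.
        rewrite /gamma_star /zeta b0 !mul0mx [(0 : 'M[R]_1) 0 0]mxE subr0 addr0.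
        by rewrite sqrtr_sqr ger0_norm// sqrtr_ge0.
      over.
    over.
  exact: integral_cst_probability.
have gamO s : gam O s = 0 by rewrite /gam /gamma c_O mulr0 !mul0r Delta_0.
split.
- rewrite Marg//; apply: eq_integral => s _.
  by rewrite gamO subr0 mul1r.
- by move=> p Op; rewrite Marg// ltnW.
move=> t.
pose F (p : 'I_P.+1) := [set w | p_hat X O c (Y w) = p :> nat /\
  lower_orthant t (Num.sqrt n%:R *: (A *m (theta_tilde X p (Y w) - theta)))].
have pms w (p : 'I_P.+1) : (O <= p)%N -> p_hat X O c (Y w) = p :> nat ->
    theta_pms X O c (Y w) = theta_tilde X p (Y w).
  move=> Op wp; rewrite /theta_pms wp (bigD1 p)//= eqxx scale1r big1 ?addr0// => q /andP[_ qp].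
  by rewrite eq_sym val_eqE (negbTE qp) scale0r.
have p_hat_bound w : exists2 p : 'I_P.+1, (O <= p)%N & p_hat X O c (Y w) = p :> nat.
  have [q /andP[Oq _] qE] := @eq_bigmax_cond _
    (fun q : 'I_P.+1 => (O <= q)%N && (c q <= `|T_stat X q (Y w)|)) (fun q => q : nat)
    (ltac:(by apply/card_gt0P; exists O; apply/andP; rewrite c_O normr_ge0)).
  by exists q.
rewrite (@measure_ord_partition _ _ _ Pr _ (fun p : 'I_P.+1 => (O <= p)%N) F); last first.
- by move=> p q w [wp _] [wq _]; apply/val_inj; rewrite /= -wp -wq.
- move=> w wt; have [p Op wp] := p_hat_bound w; exists p => //; split=> //.
  by rewrite -(pms w p).
- by move=> p Op w [wp]; rewrite /= (pms w p).
- by move=> p Op; have [] := Law p _ Op (measurable_lower_orthant t).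
have PF (p : 'I_P.+1) : (O <= p)%N -> Pr (F p) =
    (\int[Phi X sigma A p]_(z in lower_orthant (t - centre p))
       \int[lebesgue_measure]_(s in `]0%R, +oo[)
         ((1 - gam_star p z s) *
           (\prod_(q < P.+1 | (p < q)%N) gam q s) * h s)%R%:E)%E.
  move=> Op; have [_] := Law p _ Op (measurable_lower_orthant t).
  rewrite (_ : [set z | lower_orthant t _] = lower_orthant (t - centre p))//.
  by apply/seteqP; split=> z H i; have := H i; rewrite !mxE lerBrDr.
rewrite (bigD1 O)//=; congr (_ + _)%E; last first.
  apply: eq_big => [p|p /andP[Op _]]; last exact: PF.
  by rewrite -val_eqE /= andbC ltn_neqAle [in RHS]eq_sym.
(* At [O] the factor [1 - gam_star] is 1; the inner integral is constant in [z], and the probability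
   under [Phi] factors out. *)
rewrite PF// [RHS]muleC -(integral_cst _ (measurable_lower_orthant _)).
apply: eq_integral => z _; apply: eq_integral => s _.
by rewrite /gam_star /gamma_star c_O mulr0 !mul0r Delta_0 subr0 mul1r.
Qed.
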